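(* Let $r>0$ and let $X=(X,d,\mu)$ be a Borel metric measure space in which every closed ball of positive radius has positive and finite measure. Suppose that $X$ is $s$-doubling for all $s\ge r$, that $X$ has the Vitali covering property, and that for each point $x\in X$, $\mu(B(x,r)\,\triangle\, B(y,r))\to 0$ as $y\to x$. Let $p\in(1,\infty)$ and $q\in[1,\infty]$. Then the averaging operator $A_r:L^{p,q}(X)\to L^{p,q}(X)$ is compact if and only if $X$ is bounded.
   Context: Setting: $X$ is a metric space with metric $d$ and a measure $\mu$ for which all Borel sets are measurable; $B(x,s)$ is the closed ball centered at $x$ of radius $s$, and $0<\mu(B(x,s))<\infty$ for all $x\in X$, $s>0$. $L^0(X)$ is the space of (real-valued) measurable functions on $X$, with functions equal a.e. identified. $A\triangle B=(A\setminus B)\cup(B\setminus A)$. Doubling: for $s>0$, $X$ is $s$-doubling if there is $\gamma\ge1$ (possibly depending on $s$) such that $\mu(B(x,2s))\le\gamma\mu(B(x,s))$ for every $x\in X$. Vitali covering property: whenever $A\subset X$ is any subset and $\mathcal{B}$ is any family of closed balls centered in $A$ with uniformly bounded radii such that for every $x\in A$ there is a ball in $\mathcal{B}$ centered at $x$ and $\inf\{s>0\mid B(x,s)\in\mathcal{B}\}=0$, there is a (at most) countable subfamily $\mathcal{B}'\subset\mathcal{B}$ of pairwise disjoint closed balls with $\mu(A\setminus\bigcup\mathcal{B}')=0$ (for non-measurable sets, $\mu$ is read as outer measure). Lorentz space: for $f\in L^0(X)$ let $\mu_f(t)=\mu(\{x\in X\mid |f(x)|>t\})$ for $t\ge 0$,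 $f^\ast(t)=\inf\{s\in[0,\infty)\mid\mu_f(s)\le t\}$ for $t\ge0$, and $f^{\ast\ast}(t)=\frac1t\int_0^tf^\ast(s)\,ds$ for $t>0$. Put $\|f\|_{p,q}=\left(\int_0^\infty t^{q/p-1}f^\ast(t)^q\,dt\right)^{1/q}$ if $q<\infty$ and $\|f\|_{p,q}=\sup_{t\in(0,\infty)}t^{1/p}f^\ast(t)$ if $q=\infty$; define $\|f\|_{(p,q)}$ by the same formulas with $f^{\ast\ast}$ in place of $f^\ast$. $L^{p,q}(X)$ is the set of $f\in L^0(X)$ with $\|f\|_{p,q}<\infty$, equipped with either of $\|\cdot\|_{p,q}$ or $\|\cdot\|_{(p,q)}$ (for $p>1$, $\|\cdot\|_{(p,q)}$ is a norm and is equivalent to $\|\cdot\|_{p,q}$). Averaging operator: $A_rf(x)=\frac{1}{\mu(B(x,r))}\int_{B(x,r)}f(y)\,d\mu(y)$. Compact means: maps bounded sets to relatively compact sets. *)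

(* Defs.v *)
From HB Require Import structures.
From mathcomp Require Import all_boot all_order all_algebra.
From mathcomp Require Import all_classical all_reals all_analysis.

Set Implicit Arguments.
Unset Strict Implicit.
Unset Printing Implicit Defensive.

Import Order.TTheory GRing.Theory Num.Theory.
Import numFieldNormedType.Exports.

Local Open Scope classical_set_scope.
Local Open Scope ring_scope.

(* No compatibility between the two structures is built in: that open sets are
   measurable is a hypothesis of the theorem, so the sigma-algebra may be
   strictly larger than the Borel one. *)
#[short(type="metricMeasurableType")]
HB.structure Definition MetricMeasurable (R : numDomainType)
    (d : measure_display) := {X of Metric R X & Measurable d X}.

Section metric_measure.
Context {R : realType} {d : measure_display} {X : metricMeasurableType R d}.
Variable mu : {measure set X -> \bar R}.

(* The library's closed_ball is the closure of the open ball, which may be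
   strictly smaller. *)
Definition cball (x : X) (s : R) : set X := [set y | mdist x y <= s].

Definition doubling (s : R) : Prop :=
  exists2 gamma : R, 1 <= gamma &
    forall x, (mu (cball x (2 * s)) <= gamma%:E * mu (cball x s))%E.

(* A ball is just a set here: it does not remember a center or a radius.
   mu_ext mu is the outer measure induced by mu. *)
Definition vitali_covering_property : Prop :=
  forall (A : set X) (B : set (set X)),
    (exists M : R, forall b, B b ->
       exists x s, [/\ A x, 0 < s, s <= M & b = cball x s]) ->
    (forall x, A x ->
       (exists2 s, 0 < s & B (cball x s)) /\
       inf [set s | 0 < s /\ B (cball x s)] = 0) ->
    exists B' : set (set X),
      [/\ B' `<=` B, countable B', trivIset B' id &
          mu_ext mu (A `\` \bigcup_(b in B') b) = 0%E].

Definition average (r : R) (f : X -> R) (x : X) : R :=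
  (fine (mu (cball x r)))^-1 * \int[mu]_(y in cball x r) f y.

Definition distribution_function (f : X -> R) (t : R) : \bar R :=
  mu [set x | t < `|f x|].

(* Equal to +oo when the set is empty. *)
Definition rearrangement (f : X -> R) (t : R) : \bar R :=
  ereal_inf [set s%:E | s in
    [set s : R | 0 <= s /\ (distribution_function f s <= t%:E)%E]].

Definition maximal_rearrangement (f : X -> R) (t : R) : \bar R :=
  ((t^-1)%:E * \int[lebesgue_measure]_(s in `[0%R, t]) rearrangement f s)%E.

(* The value at q = -oo is irrelevant, since q >= 1 in every use. *)
Definition lorentz_functional (p : R) (q : \bar R) (g : R -> \bar R) : \bar R :=
  match q with
  | q%:E => ((\int[lebesgue_measure]_(t in `]0%R, +oo[)
               ((t `^ (q / p - 1))%:E * (g t `^ q))) `^ q^-1)%E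
  | +oo%E => ereal_sup [set ((t `^ p^-1)%:E * g t)%E | t in `]0, +oo[]
  | -oo%E => 0%E
  end.

(* ||f||_{p,q} *)
Definition lorentz_norm (p : R) (q : \bar R) (f : X -> R) : \bar R :=
  lorentz_functional p q (rearrangement f).

(* ||f||_{(p,q)} *)
Definition lorentz_maximal_norm (p : R) (q : \bar R) (f : X -> R) : \bar R :=
  lorentz_functional p q (maximal_rearrangement f).

(* L^{p,q}, as a set of a.e.-equality classes; N is the (quasi-)norm it is
   equipped with. A class coerces to a function through a representative. *)
Definition lorentz_space (p : R) (q : \bar R) (N : (X -> R) -> \bar R) : Type :=
  {f : {mfun_ mu, X >-> R} | (lorentz_norm p q f < +oo)%E}.

Definition lorentz_fun p q N (f : lorentz_space p q N) : X -> R := sval f.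

End metric_measure.

Coercion lorentz_fun : lorentz_space >-> Funclass.

Section lorentz_topology.
Context {R : realType} {d : measure_display} {X : metricMeasurableType R d}.
Variables (mu : {measure set X -> \bar R}) (p : R) (q : \bar R).
Variable N : (X -> R) -> \bar R.

Notation L := (lorentz_space mu p q N).

HB.instance Definition _ := Choice.copy L
  {f : {mfun_ mu, X >-> R} | (lorentz_norm mu p q f < +oo)%E}.

Definition lorentz_open : set (set L) :=
  [set U | forall f : L, U f -> exists2 e : R, 0 < e &
    forall g : L, (N (fun x => g x - f x)%R < e%:E)%E -> U g].

Let openT : lorentz_open setT.
Proof. by move=> f _; exists 1. Qed.

Let openI : setI_closed lorentz_open.
Proof.
move=> U V oU oV f [/oU[e e0 eU] /oV[e' e'0 eV]].
exists (Num.min e e'); first by rewrite lt_min e0.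
by move=> g; rewrite EFin_min lt_min => /andP[/eU Ug /eV Vg].
Qed.

Let open_bigU (I : Type) (F : I -> set L) :
  (forall i, lorentz_open (F i)) -> lorentz_open (\bigcup_i F i).
Proof.
move=> oF f [i _ /oF[e e0 eF]].
by exists e => // g /eF Fg; exists i.
Qed.

HB.instance Definition _ :=
  isOpenTopological.Build L openT openI open_bigU.

Definition lorentz_bounded (E : set L) : Prop :=
  exists M : R, forall f, E f -> (N f <= M%:E)%E.

Definition compact_operator (T : L -> L) : Prop :=
  forall E : set L, lorentz_bounded E -> compact (closure (T @` E)).

(* f |-> average r f defines a map from L^{p,q} to itself (necessarily
   unique), and this map is a compact operator. *)
Definition averaging_operator_compact (r : R) : Prop :=
  exists2 T : L -> L,
    (forall f, {ae mu, forall x, T f x = average mu r f x}) &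
    compact_operator T.

End lorentz_topology.

Definition bounded_space {R : realType} (X : metricType R) : Prop :=
  exists M : R, forall x y : X, mdist x y <= M.

(* Main.v *)
(* Both quasi-norms enter only through two estimates: the weak-type bound
   [mu {|f| > l} <= (C N f / l)^p], which gives
   [\int_E |f| <= l mu E + C (N f)^p l^(1-p)], and the interpolation bound
   [N f <= K a (b / a)^(1/p)] when [|f| <= a] and [\int |f| <= b].

   If X is bounded, doubling bounds [mu (B(x, r))] away from 0, so the averages
   of a bounded family are uniformly bounded and, by the first estimate and
   ball continuity, equicontinuous.  Limits along ultrafilters stay in such an
   equicontinuous family; the Vitali property covers X by finitely many small
   balls up to small measure, so that closeness at finitely many points gives
   L^1-closeness, hence N-closeness by interpolation.

   If X is unbounded, take points [x_i] at mutual distance > 4r, the indicators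
   [f_i] of [B(x_i, 2r)] normalised in N, and the functionals
   [mu(B(x_i, r))^(1/p-1) \int_{B(x_i, r)} g], which are Lipschitz in g for N
   uniformly in i.  They separate the averages of the [f_i] uniformly, so these
   averages have no cluster point.

   Neither half needs the quasi-triangle inequality for N: open neighbourhoods
   are built from L^1-distances and from the above functionals. *)
Require Import Defs.
From mathcomp Require Import all_boot all_order all_algebra.
From mathcomp Require Import all_classical all_reals all_analysis.
From mathcomp Require Import measurable_realfun ring lra.

Set Implicit Arguments.
Unset Strict Implicit.
Unset Printing Implicit Defensive.

Import Order.TTheory GRing.Theory Num.Theory.
Import numFieldNormedType.Exports.
Local Open Scope classical_set_scope.
Local Open Scope ring_scope.

(** * Integrals of powers *)

Section integral_auxiliary.
Context d (T : measurableType d) (R : realType).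
Variable mu : {measure set T -> \bar R}.
Local Open Scope ereal_scope.

(** The rearrangements are integrated without a proof that they are measurable. For nonnegative
    functions monotonicity follows from the definition of the integral as a supremum over the simple
    functions below. *)
Lemma ge0_le_integralW (D : set T) (f g : T -> \bar R) :
  (forall x, D x -> 0 <= f x) -> (forall x, D x -> f x <= g x) ->
  \int[mu]_(x in D) f x <= \int[mu]_(x in D) g x.
Proof.
move=> f0 fg; rewrite integral_mkcond [leRHS]integral_mkcond.
have fg' x : (f \_ D) x <= (g \_ D) x by exact: lee_restrict.
have f0' x : 0 <= (f \_ D) x by apply: erestrict_ge0.
rewrite !ge0_integralTE//; last by move=> x; exact: le_trans (fg' x).
apply: ereal_sup_le => _ [h hf <-]; exists h => // x.
exact: le_trans (hf x) (fg' x).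
Qed.

End integral_auxiliary.

Section integral_powR.
Context {R : realType}.
Local Notation leb := (@lebesgue_measure R).

Lemma integral_powR (a u v : R) : a != 0 -> 0 < u -> u < v ->
  (\int[leb]_(t in `[u, v]) (t `^ (a - 1))%:E =
    (a^-1 * (v `^ a - u `^ a))%:E)%E.
Proof.
move=> a0 u0 uv.
have dF (t : R) : 0 < t ->
    is_derive t 1 (fun x : R => a^-1 * x `^ a) (t `^ (a - 1)).
  move=> t0; have := @is_derive1_powR R a t t0 => h.
  have -> : t `^ (a - 1) = a^-1 *: (a * t `^ (a - 1)).
    by rewrite /GRing.scale/= mulrA mulVf// mul1r.
  exact: is_deriveZ.
have cF (t : R) : 0 < t -> {for t, continuous (fun x : R => a^-1 * x `^ a)}.
  move=> t0; apply/differentiable_continuous/derivable1_diffP.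
  by have [] := dF _ t0.
rewrite (@continuous_FTC2 _ _ (fun x : R => a^-1 * x `^ a))//.
- by rewrite -EFinB mulrBr.
- apply: continuous_in_subspaceT => t; rewrite inE/= in_itv/= => /andP[ut _].
  apply/differentiable_continuous/derivable1_diffP.
  by have [] := @is_derive1_powR R (a - 1) t (lt_le_trans u0 ut).
- split.
  + move=> t; rewrite in_itv/= => /andP[ut _].
    by have [] := dF _ (lt_trans u0 ut).
  + exact/cvg_at_right_filter/cF.
  + exact/cvg_at_left_filter/cF/(lt_trans u0).
- move=> t; rewrite in_itv/= => /andP[ut _].
  by rewrite derive1E; have [_ ->] := dF _ (lt_trans u0 ut).
Qed.

Lemma measurable_powR_EFin (D : set (measurableTypeR R)) (a : R) :
  measurable_fun D (EFin \o (@powR R ^~ a)).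
Proof.
by apply/measurable_EFinP/measurable_funTS; exact: measurable_powR.
Qed.

Lemma integral_powR_near0_le (a m : R) : 0 < a -> 0 < m ->
  (\int[leb]_(t in `]0%R, m]) (t `^ (a - 1))%:E <= (a^-1 * m `^ a)%:E)%E.
Proof.
(* Exhaust []0, m]] by intervals away from 0, where the fundamental theorem of calculus applies;
   [n.+2] keeps them nondegenerate. *)
move=> a0 m0; pose F (n : nat) := `[m / n.+2%:R, m]%classic : set R.
have -> : `]0%R, m]%classic = \bigcup_n F n.
  apply/seteqP; split => [t|t [n _]]; rewrite /F/= !in_itv/=.
    move=> /andP[t0 tm]; exists (Num.truncn (m / t)) => //=.
    rewrite /F/= in_itv/= tm andbT ler_pdivrMr// mulrC -ler_pdivrMr//.
    rewrite (le_trans (ltW (truncnS_gt _)))// ler_nat//.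
  by move=> /andP[+ ->]; rewrite andbT; apply: lt_le_trans; rewrite divr_gt0.
have FS : nondecreasing_seq F.
  move=> n k nk; apply/subsetPset => t; rewrite /F/= !in_itv/= => /andP[+ ->].
  rewrite andbT; apply: le_trans; rewrite ler_pM2l// lef_pV2 ?posrE//.
  by rewrite ler_nat !ltnS.
have p_ge0 i (t : R) : F i t -> (0 <= (t `^ (a - 1))%:E)%E.
  by rewrite lee_fin powR_ge0.
have cvF := @ge0_nondecreasing_set_cvg_integral _ (measurableTypeR R) R F
  (EFin \o (@powR R ^~ (a - 1))) leb FS (fun=> measurable_itv _)
  (fun=> measurable_powR_EFin _) p_ge0.
apply: (cvge_to_le cvF); apply: nearW => n;
  rewrite integral_powR ?gt_eqF ?divr_gt0//; last first.
  by rewrite ltr_pdivrMr// ltr_pMr// ltr1n.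
by rewrite lee_fin ler_pM2l ?invr_gt0// gerBl powR_ge0.
Qed.

Lemma integral_powR_neary_le (a m : R) : 0 < a -> 0 < m ->
  (\int[leb]_(t in `]m, +oo[) (t `^ (- a - 1))%:E <=
   (a^-1 * m `^ (- a))%:E)%E.
Proof.
move=> a0 m0; pose F (n : nat) := `[m, m + n.+1%:R]%classic : set R.
apply: (@le_trans _ _ (\int[leb]_(t in \bigcup_n F n) (t `^ (- a - 1))%:E)%E).
  apply: ge0_subset_integral => //.
  - by apply: bigcup_measurable => n _; exact: measurable_itv.
  - exact: measurable_powR_EFin.
  - by move=> t _; rewrite lee_fin powR_ge0.
  - move=> t; rewrite /= in_itv/= andbT => mt.
    exists (Num.truncn (t - m)) => //=; rewrite /F/= in_itv/= (ltW mt)/=.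
    by rewrite -lerBlDl ltW// truncnS_gt.
have FS : nondecreasing_seq F.
  move=> n k nk; apply/subsetPset => t; rewrite /F/= !in_itv/= => /andP[-> +]/=.
  by move=> /le_trans; apply; rewrite lerD2l ler_nat ltnS.
have p_ge0 i (t : R) : F i t -> (0 <= (t `^ (- a - 1))%:E)%E.
  by rewrite lee_fin powR_ge0.
have cvF := @ge0_nondecreasing_set_cvg_integral _ (measurableTypeR R) R F
  (EFin \o (@powR R ^~ (- a - 1))) leb FS (fun=> measurable_itv _)
  (fun=> measurable_powR_EFin _) p_ge0.
apply: (cvge_to_le cvF); apply: nearW => n;
  rewrite integral_powR ?oppr_eq0 ?gt_eqF//; last first.
  by rewrite ltrDl.
rewrite invrN mulNr -mulrN lee_fin ler_pM2l ?invr_gt0// opprB gerBl.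
exact: powR_ge0.
Qed.

End integral_powR.

(** * Weak-type and interpolation bounds for Lorentz quasi-norms *)

Section lorentz_functional_bounds.
Context {R : realType}.
Variables (p : R) (q : \bar R).
Hypotheses (p_gt1 : 1 < p) (q_ge1 : (1 <= q)%E).
Local Notation leb := (@lebesgue_measure R).

Let p_gt0 : 0 < p. Proof. exact: lt_trans p_gt1. Qed.

(** It suffices to integrate over [[t0 / 2, t0[], where [t] is comparable to [t0], so the sign of
    the exponent [s / p - 1] does not matter. For [q = +oo] the point [t0 / 2] is enough. *)
Lemma lorentz_functional_ge : exists2 C : R, 0 < C &
  forall (g : R -> \bar R) (t0 l : R), 0 < t0 -> 0 <= l ->
    (forall t, 0 < t -> (0 <= g t)%E) ->
    (forall t, 0 < t < t0 -> (l%:E <= g t)%E) ->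
    ((l * t0 `^ p^-1)%:E <= C%:E * lorentz_functional p q g)%E.
Proof.
have t02 (t0 : R) : 0 < t0 -> 2 `^ p^-1 * (t0 / 2) `^ p^-1 = t0 `^ p^-1.
  by move=> ?; rewrite -powRM ?divr_ge0 ?ltW// mulrC divfK.
case: q q_ge1 => [s| |]//.
- rewrite lee_fin => s1; have s0 : 0 < s := lt_le_trans ltr01 s1.
  exists (2 `^ s^-1 * 2 `^ p^-1) => [|g t0 l t00 l0 g0 lg].
    by rewrite mulr_gt0// powR_gt0.
  (* [k] is a lower bound of the integrand on [[t0 / 2, t0[], from
     [t ^ (s / p) >= (t0 / 2) ^ (s / p)], [1 / t >= 1 / t0] and [g t >= l]. *)
  pose k := (t0 / 2) `^ (s / p) / t0 * l `^ s.
  have k0 : 0 <= k by rewrite mulr_ge0 ?divr_ge0 ?powR_ge0// ltW.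
  have ge_int : ((2^-1 * (t0 / 2) `^ (s / p) * l `^ s)%:E <=
      \int[leb]_(t in `]0%R, +oo[) ((t `^ (s / p - 1))%:E * (g t `^ s)))%E.
    apply: (@le_trans _ _ (\int[leb]_(t in `]0%R, +oo[)
      ((cst k%:E \_ `[(t0 / 2)%R, t0[) t))%E).
      rewrite -integral_mkcondr setIidr; last first.
        move=> t; rewrite /= !in_itv/= andbT => /andP[+ _].
        by apply: lt_le_trans; rewrite divr_gt0.
      rewrite integral_cst//= lebesgue_measure_itv/= lte_fin.
      rewrite ltr_pdivrMr// ltr_pMr// ltr1n -EFinD -EFinM lee_fin.
      rewrite /k le_eqVlt; apply/orP; left; apply/eqP.
      by field; rewrite gt_eqF.
    apply: ge0_le_integralW => t.
      by move=> _; apply: erestrict_ge0 => //; rewrite lee_fin.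
    rewrite /= in_itv/= andbT => tgt0.
    rewrite patchE; case: ifPn; last first.
      by move=> _; rewrite mule_ge0// ?lee_fin ?powR_ge0// poweR_ge0.
    rewrite inE/= in_itv/= => /andP[tge tlt].
    rewrite /k EFinM lee_pmul ?lee_fin ?powR_ge0//.
    - by rewrite divr_ge0 ?powR_ge0// ltW.
    - rewrite powRB; last by rewrite (gt_eqF tgt0) implybT.
      rewrite (powRr1 (ltW tgt0)).
      rewrite ler_pM ?powR_ge0 ?invr_ge0 ?(ltW t00)//.
        by rewrite ge0_ler_powR ?nnegrE ?divr_ge0 ?(ltW s0) ?(ltW t00)
          ?(ltW tgt0)// ltW.
      by rewrite lef_pV2 ?posrE// ltW.
    - rewrite -poweR_EFin gt0_ler_poweR ?in_itv/= ?leey ?andbT ?lee_fin//.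
      + exact: ltW.
      + exact: g0.
      + by apply: lg; rewrite tgt0.
  have k'0 : 0 <= 2^-1 * (t0 / 2) `^ (s / p) * l `^ s.
    by rewrite !mulr_ge0 ?powR_ge0// invr_ge0.
  apply: (@le_trans _ _ ((2 `^ s^-1 * 2 `^ p^-1)%:E *
      ((2^-1 * (t0 / 2) `^ (s / p) * l `^ s)%:E `^ s^-1))%E); last first.
    rewrite lee_pmul2l// ?lte_fin ?mulr_gt0 ?powR_gt0//.
    rewrite gt0_ler_poweR ?invr_ge0 ?in_itv/= ?leey ?andbT ?lee_fin ?(ltW s0)//.
    exact: le_trans ge_int.
  rewrite poweR_EFin -EFinM lee_fin.
  move: k'0; set A := (t0 / 2) `^ (s / p); have A0 : 0 <= A by exact: powR_ge0.
  move=> _; rewrite powRM ?mulr_ge0 ?powR_ge0 ?invr_ge0//.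
  rewrite [(2^-1 * A) `^ _]powRM ?invr_ge0// /A.
  rewrite -!powRrM [s / p]mulrC mulfK ?gt_eqF// mulfV ?gt_eqF// powRr1//.
  rewrite [leRHS](_ : _ = (2 `^ s^-1 * 2^-1 `^ s^-1) *
    (2 `^ p^-1 * (t0 / 2) `^ p^-1) * l); last by ring.
  by rewrite t02// -powRM// ?divff ?invr_ge0// powR1 mul1r mulrC.
- move=> _; exists (2 `^ p^-1) => [|g t0 l t00 l0 g0 lg];
    first by rewrite powR_gt0.
  have t0' : 0 < t0 / 2 by rewrite divr_gt0.
  apply: (@le_trans _ _ ((2 `^ p^-1)%:E *
    (((t0 / 2) `^ p^-1)%:E * g (t0 / 2)%R))%E).
    rewrite muleA -EFinM t02// mulrC EFinM.
    rewrite lee_pmul2l// ?lte_fin ?powR_gt0//.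
    by apply: lg; rewrite t0' ltr_pdivrMr// ltr_pMr// ltr1n.
  rewrite lee_pmul2l// ?lte_fin ?powR_gt0//.
  by apply: ereal_sup_ubound; exists (t0 / 2) => //=; rewrite in_itv/= t0'.
Qed.

(** Use [g <= c] up to [m] and the power bound beyond. The integrand is then of order [t ^ (a - 1)]
    near 0 and [t ^ (- b - 1)] at infinity, where [b > 0] because [th > 1 / p]. For [q = +oo] the
    same split bounds the supremum. *)
Lemma lorentz_functional_le (th : R) : p^-1 < th -> exists2 K : R, 0 < K &
  forall (g : R -> \bar R) (c m : R), 0 < c -> 0 < m ->
    (forall t, 0 < t -> (0 <= g t)%E) ->
    (forall t, 0 < t -> (g t <= c%:E)%E) ->
    (forall t, 0 < t -> (g t <= (c * (m / t) `^ th)%:E)%E) ->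
    (lorentz_functional p q g <= (K * (c * m `^ p^-1))%:E)%E.
Proof.
move=> pth; have pV0 : 0 < p^-1 by rewrite invr_gt0.
have th0 : 0 < th := lt_trans pV0 pth.
case: q q_ge1 => [s| |]//.
- rewrite lee_fin => s1; have s0 : 0 < s := lt_le_trans ltr01 s1.
  pose a := s / p; pose b := th * s - s / p.
  have a0 : 0 < a by rewrite divr_gt0.
  have b0 : 0 < b by rewrite /b [s / p]mulrC -mulrBl mulr_gt0// subr_gt0.
  exists ((a^-1 + b^-1) `^ s^-1) => [|g c m c0 m0 g0 gc gcm].
    by rewrite powR_gt0// addr_gt0 ?invr_gt0.
  pose h1 (t : R) := c `^ s * t `^ (a - 1).
  pose h2 (t : R) := c `^ s * m `^ (th * s) * t `^ (- b - 1).
  pose h (t : R) := if t <= m then h1 t else h2 t.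
  have h10 t : 0 <= h1 t by rewrite mulr_ge0 ?powR_ge0.
  have h20 t : 0 <= h2 t by rewrite !mulr_ge0 ?powR_ge0.
  have h0 t : 0 <= h t by rewrite /h; case: ifP.
  have mh1 (D : set (measurableTypeR R)) : measurable_fun D h1.
    by apply: measurable_funM => //; apply: measurable_funTS;
      exact: measurable_powR.
  have mh2 (D : set (measurableTypeR R)) : measurable_fun D h2.
    by apply: measurable_funM => //; apply: measurable_funTS;
      exact: measurable_powR.
  have mh (D : set (measurableTypeR R)) : measurable_fun D h.
    apply: measurable_funTS; apply: measurable_fun_ifT => //.
    exact: measurable_fun_ler.
  have gh t : 0 < t -> ((t `^ (s / p - 1))%:E * (g t `^ s) <= (h t)%:E)%E.
    move=> t0; rewrite /h /h1 /h2; case: ifPn => tm.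
      rewrite [c `^ s * _]mulrC [leRHS]EFinM lee_pmul2l ?lte_fin ?powR_gt0//.
      rewrite -poweR_EFin gt0_ler_poweR ?in_itv/= ?leey ?andbT ?lee_fin ?g0
        ?gc//.
        exact: ltW.
      exact: ltW.
    have -> : c `^ s * m `^ (th * s) * t `^ (- b - 1) =
        t `^ (s / p - 1) * (c * (m / t) `^ th) `^ s.
      have -> : (c * (m / t) `^ th) `^ s =
          c `^ s * (m `^ (th * s) * t `^ (- 1 * (th * s))).
        rewrite (powRrM t) powR_inv1 ?(ltW t0)// -powRM ?invr_ge0 ?ltW//.
        by rewrite powRM ?powR_ge0 ?(ltW c0)// -powRrM.
      rewrite [RHS](_ : _ = c `^ s * m `^ (th * s) *
        (t `^ (s / p - 1) * t `^ (- 1 * (th * s)))); last by ring.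
      rewrite -powRD; last by rewrite (gt_eqF t0) implybT.
      by congr (_ * _ `^ _); rewrite /b; ring.
    rewrite [leRHS]EFinM lee_pmul2l ?lte_fin ?powR_gt0//.
    rewrite -poweR_EFin gt0_ler_poweR ?in_itv/= ?leey ?andbT ?lee_fin ?g0
      ?gcm//.
      exact: ltW.
    by rewrite mulr_ge0 ?powR_ge0 ?ltW.
  have le_int : (\int[leb]_(t in `]0%R, +oo[)
      ((t `^ (s / p - 1))%:E * (g t `^ s)) <=
      (c `^ s * m `^ a * (a^-1 + b^-1))%:E)%E.
    apply: (@le_trans _ _ (\int[leb]_(t in `]0%R, +oo[) (h t)%:E)%E).
      apply: ge0_le_integralW => t; rewrite /= in_itv/= andbT.
        by move=> t0; rewrite mule_ge0// ?lee_fin ?powR_ge0// poweR_ge0.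
      exact: gh.
    have -> : `]0%R, +oo[%classic = `]0%R, m] `|` `]m, +oo[ :> set R.
      apply/seteqP; split=> t; rewrite /= !in_itv/= !andbT.
        by move=> ->; rewrite /=; have [] := leP t m; [left|right].
      by move=> [/andP[]//|]; exact: lt_trans.
    rewrite ge0_integral_setU//=; first last.
    - apply/disj_setPS => t [/=]; rewrite !in_itv/= andbT => /andP[_ tm] mt.
      by have := lt_le_trans mt tm; rewrite ltxx.
    - by move=> t _; rewrite lee_fin.
    - exact/measurable_EFinP.
    rewrite mulrDr EFinD; apply: leeD.
      rewrite (@eq_integral _ (measurableTypeR R) _ _ _
        (fun t => ((c `^ s)%:E * (t `^ (a - 1))%:E)%E)).
        rewrite ge0_integralZl ?lee_fin ?powR_ge0//; first last.
        - by move=> t _; rewrite lee_fin powR_ge0.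
        - exact: measurable_powR_EFin.
        rewrite -mulrA [leRHS]EFinM lee_pmul2l ?lte_fin ?powR_gt0// mulrC.
        exact: integral_powR_near0_le.
      by move=> t; rewrite inE/= in_itv/= => /andP[t0 tm]; rewrite /h tm -EFinM.
    rewrite (@eq_integral _ (measurableTypeR R) _ _ _
      (fun t => ((c `^ s * m `^ (th * s))%:E * (t `^ (- b - 1))%:E)%E)).
      rewrite ge0_integralZl ?lee_fin ?mulr_ge0 ?powR_ge0//; first last.
      - by move=> t _; rewrite lee_fin powR_ge0.
      - exact: measurable_powR_EFin.
      have -> : c `^ s * m `^ a / b = (c `^ s * m `^ (th * s)) *
        (b^-1 * m `^ (- b)).
        have -> : a = th * s + - b by rewrite /b /a; ring.
        by rewrite powRD; [ring|rewrite (gt_eqF m0) implybT].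
      rewrite [leRHS]EFinM lee_pmul2l ?lte_fin ?mulr_gt0 ?powR_gt0//.
      exact: integral_powR_neary_le.
    move=> t; rewrite inE/= in_itv/= andbT => mt.
    by rewrite /h leNgt mt -EFinM.
  have -> : (a^-1 + b^-1) `^ s^-1 * (c * m `^ p^-1) =
      (c `^ s * m `^ a * (a^-1 + b^-1)) `^ s^-1.
    have ab0 : 0 <= a^-1 + b^-1 by rewrite addr_ge0 ?invr_ge0 ?ltW.
    rewrite powRM ?mulr_ge0 ?powR_ge0// [(_ * m `^ a) `^ _]powRM ?powR_ge0//.
    rewrite -!powRrM mulfV ?gt_eqF// (powRr1 (ltW c0)) /a [s / p]mulrC mulfK
      ?gt_eqF//.
    by rewrite [RHS]mulrC.
  rewrite -poweR_EFin gt0_ler_poweR ?invr_ge0 ?in_itv/= ?leey ?andbT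
    ?(ltW s0)//.
  - apply: integral_ge0 => t; rewrite /= in_itv/= andbT => t0.
    by rewrite mule_ge0// ?lee_fin ?powR_ge0// poweR_ge0.
  - rewrite lee_fin !mulr_ge0 ?powR_ge0// addr_ge0// invr_ge0 ltW//.
- move=> _; exists 1 => // g c m c0 m0 g0 gc gcm; rewrite mul1r.
  apply: ge_ereal_sup => _ [t /= + <-]; rewrite in_itv/= andbT => t0.
  have [tm|mt] := leP t m.
    apply: (@le_trans _ _ ((t `^ p^-1)%:E * c%:E)%E).
      by rewrite lee_pmul2l ?lte_fin ?powR_gt0// gc.
    rewrite -EFinM lee_fin mulrC ler_pM2l// ge0_ler_powR ?nnegrE//; exact: ltW.
  apply: (@le_trans _ _ ((t `^ p^-1)%:E * (c * (m / t) `^ p^-1)%:E)%E).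
    rewrite lee_pmul2l ?lte_fin ?powR_gt0//; apply: (le_trans (gcm _ t0)).
    rewrite lee_fin ler_pM2l// ger_powR ?(ltW pth)//.
    by rewrite divr_gt0//= ler_pdivrMr// mul1r ltW.
  rewrite -EFinM lee_fin mulrCA -powRM ?divr_ge0 ?(ltW t0) ?(ltW m0)//.
  by rewrite [t * _]mulrC divfK ?gt_eqF.
Qed.

End lorentz_functional_bounds.

(** * Bounds on the rearrangement and on its averages *)

Section rearrangement_bounds.
Context {R : realType} {d : measure_display} {X : metricMeasurableType R d}.
Variable mu : {measure set X -> \bar R}.
Local Notation leb := (@lebesgue_measure R).

Lemma measurable_superlevel (f : X -> R) (l : R) :
  measurable_fun [set: X] f -> measurable [set x | l < `|f x|].
Proof.
move=> mf; have mnf : measurable_fun setT (EFin \o (Num.norm \o f)).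
  by apply/measurable_EFinP; exact: measurableT_comp.
by have := emeasurable_fun_o_infty measurableT mnf l%:E; rewrite setTI.
Qed.

Lemma rearrangement_ge0 (f : X -> R) t : (0 <= rearrangement mu f t)%E.
Proof. by apply: le_ereal_inf_tmp => _ [s [s0 _] <-]; rewrite lee_fin. Qed.

Lemma rearrangement_le (f : X -> R) (t s : R) : 0 <= s ->
  (distribution_function mu f s <= t%:E)%E -> (rearrangement mu f t <= s%:E)%E.
Proof. by move=> s0 fs; apply: ereal_inf_lbound; exists s. Qed.

Lemma rearrangement_ge (f : X -> R) (t l : R) : measurable_fun [set: X] f ->
  (t%:E < distribution_function mu f l)%E -> (l%:E <= rearrangement mu f t)%E.
Proof.
move=> mf tl; apply: le_ereal_inf_tmp => _ [s [s0 ts] <-];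
  rewrite lee_fin leNgt.
apply/negP => sl.
suff ls : (distribution_function mu f l <= distribution_function mu f s)%E.
  by have := lt_le_trans tl (le_trans ls ts); rewrite ltxx.
apply: le_measure; rewrite ?inE; [exact: measurable_superlevel..|].
by move=> x; exact: lt_trans.
Qed.

Lemma maximal_rearrangement_ge0 (f : X -> R) t : 0 < t ->
  (0 <= maximal_rearrangement mu f t)%E.
Proof.
move=> t0; rewrite mule_ge0 ?lee_fin ?invr_ge0 ?(ltW t0)//.
by apply: integral_ge0 => s _; exact: rearrangement_ge0.
Qed.

Lemma maximal_rearrangement_ge (f : X -> R) (t l : R) : 0 <= l -> 0 < t ->
  (forall s, 0 <= s <= t -> (l%:E <= rearrangement mu f s)%E) ->
  (l%:E <= maximal_rearrangement mu f t)%E.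
Proof.
move=> l0 t0 lf; rewrite /maximal_rearrangement lee_pdivlMl// -EFinM.
apply: (@le_trans _ _ (\int[leb]_(s in `[0%R, t]) (cst l%:E) s)%E).
  rewrite integral_cst//= lebesgue_measure_itv/= lte_fin t0.
  by rewrite -EFinD -EFinM subr0 mulrC.
apply: ge0_le_integralW => s; first by rewrite lee_fin.
by rewrite /= in_itv/=; exact: lf.
Qed.

Lemma maximal_rearrangement_le_cst (f : X -> R) (t c : R) : 0 < t ->
  (forall s, 0 <= s -> (rearrangement mu f s <= c%:E)%E) ->
  (maximal_rearrangement mu f t <= c%:E)%E.
Proof.
move=> t0 fc; rewrite /maximal_rearrangement lee_pdivrMl// -EFinM.
apply: (@le_trans _ _ (\int[leb]_(s in `[0%R, t]) (cst c%:E) s)%E).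
  apply: ge0_le_integralW => s; first by rewrite rearrangement_ge0.
  by rewrite /= in_itv/= => /andP[s0 _]; exact: fc.
rewrite integral_cst//= lebesgue_measure_itv/= lte_fin t0.
by rewrite -EFinD -EFinM subr0 mulrC.
Qed.

(** The average of [s ^ (- th)] over [[0, t]] is [t ^ (- th) / (1 - th)], finite because [th < 1]; a
    power bound thus survives averaging up to a constant. *)
Lemma maximal_rearrangement_le_powR (f : X -> R) (t c m th : R) : 0 < t ->
  0 <= c -> 0 <= m -> th < 1 ->
  (forall s, 0 <= s -> (rearrangement mu f s <= c%:E)%E) ->
  (forall s, 0 < s -> (rearrangement mu f s <= (c * (m / s) `^ th)%:E)%E) ->
  (maximal_rearrangement mu f t <= ((1 - th)^-1 * c * (m / t) `^ th)%:E)%E.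
Proof.
move=> t0 c0 m0 th1 fc fcm; rewrite /maximal_rearrangement lee_pdivrMl// -EFinM.
have th1' : 0 < 1 - th by rewrite subr_gt0.
have msE s : 0 < s -> (m / s) `^ th = m `^ th * s `^ ((1 - th) - 1).
  move=> s0; rewrite powRM ?invr_ge0 ?(ltW s0)//; congr (_ * _).
  by rewrite -powR_inv1 ?(ltW s0)// -powRrM; congr (_ `^ _); ring.
pose k := c * m `^ th.
have k0 : 0 <= k by rewrite mulr_ge0 ?powR_ge0.
(* At 0 the power bound says nothing, so [h] takes the constant bound there; this point is dropped
   before integrating. *)
pose h (s : R) := if 0 < s then k * s `^ ((1 - th) - 1) else c.
have mh : measurable_fun `]0%R, t] (EFin \o h).
  apply: (eq_measurable_fun (fun s : R => (k * s `^ ((1 - th) - 1))%:E)).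
    by move=> s; rewrite inE/= in_itv/= /h => /andP[-> _].
  apply/measurable_EFinP/measurable_funM => //.
  by apply: measurable_funTS; exact: measurable_powR.
apply: (@le_trans _ _ (\int[leb]_(s in `[0%R, t]) (h s)%:E)%E).
  apply: ge0_le_integralW => s; first by rewrite rearrangement_ge0.
  rewrite /= in_itv/= => /andP[s0 _]; rewrite /h; case: ifPn => s0'.
    by rewrite /k -mulrA -msE//; exact: fcm.
  exact: fc.
rewrite -(integral_itv_obnd_cbnd mh).
rewrite (@eq_integral _ (measurableTypeR R) _ _ _
    (fun s => (k%:E * (s `^ ((1 - th) - 1))%:E)%E)); last first.
  by move=> s; rewrite inE/= in_itv/= /h => /andP[-> _].
rewrite ge0_integralZl ?lee_fin//; first last.
- by move=> s _; rewrite lee_fin powR_ge0.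
- exact: measurable_powR_EFin.
apply: (@le_trans _ _ (k%:E * ((1 - th)^-1 * t `^ (1 - th))%:E)%E).
  apply: lee_pmul => //; last exact: integral_powR_near0_le.
  by apply: integral_ge0 => s _; rewrite lee_fin powR_ge0.
rewrite -EFinM lee_fin msE// /k le_eqVlt; apply/orP; left; apply/eqP.
rewrite -(mulr_powRB1 (ltW t0) th1').
by ring.
Qed.

Lemma rearrangement_le_cst (f : X -> R) (a t : R) : 0 <= a -> 0 <= t ->
  (forall x, `|f x| <= a) -> (rearrangement mu f t <= a%:E)%E.
Proof.
move=> a0 t0 fa; apply: rearrangement_le => //.
rewrite /distribution_function (_ : mkset _ = set0) ?measure0 ?lee_fin//.
by rewrite -subset0 => x /=; rewrite ltNge fa.
Qed.

(** Markov's inequality gives the bound [b / t], and [min(a, b / t) <= a * (b / a / t) ^ th] for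
    [0 < th < 1]. An exponent below 1 is wanted because [1 / t] itself is not integrable at 0. *)
Lemma rearrangement_le_powR (f : X -> R) (a b t th : R) : 0 < a -> 0 < b ->
  0 < t -> 0 < th < 1 -> measurable_fun [set: X] f ->
  (forall x, `|f x| <= a) -> (\int[mu]_x `|f x|%:E <= b%:E)%E ->
  (rearrangement mu f t <= (a * (b / a / t) `^ th)%:E)%E.
Proof.
move=> a0 b0 t0 /andP[th0 th1] mf fa fb.
have [bat|bat] := leP (b / a / t) 1; last first.
  apply: (le_trans (rearrangement_le_cst (ltW a0) (ltW t0) fa)).
  rewrite lee_fin ler_pMr// -(powRr0 (b / a / t)).
  by rewrite ler_powR// ltW.
apply: (@le_trans _ _ (b / t)%:E); last first.
  have -> : b / t = a * (b / a / t) by field; rewrite !gt_eqF.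
  rewrite lee_fin ler_pM2l// -[leLHS]powRr1 ?divr_ge0 ?(ltW b0) ?(ltW a0)
    ?(ltW t0)//.
  by rewrite ger_powR ?bat ?andbT ?divr_gt0// ltW.
apply: rearrangement_le; first by rewrite divr_ge0// ltW.
have bt0 : 0 < b / t by rewrite divr_gt0.
have mf' : measurable_fun setT (EFin \o f) by exact/measurable_EFinP.
(* This is Markov's inequality, with the identity as the comparison function. *)
have := @le_integral_comp_abse _ _ _ mu setT measurableT (EFin \o f) (b / t) id.
move=> /(_ (@measurable_id _ _ _) (fun _ => id) (fun _ _ _ _ => id) mf' bt0).
rewrite setTI => H.
have {}H := le_trans H fb; rewrite -lee_pdivlMl// -EFinM in H.
rewrite (_ : (b / t)^-1 * b = t) in H; last by field; rewrite !gt_eqF.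
apply: le_trans H; apply: le_measure; rewrite ?inE.
- exact: measurable_superlevel.
- have mnf : measurable_fun setT (EFin \o (Num.norm \o f)).
    by apply/measurable_EFinP; exact: measurableT_comp.
  have := emeasurable_fun_c_infty measurableT mnf (b / t)%:E.
  by rewrite setTI.
- by move=> x /= /ltW; rewrite lee_fin.
Qed.

End rearrangement_bounds.

(** * Weak-type, interpolation and integral bounds for both norms *)

Section lorentz_norm_estimates.
Context {R : realType} {d : measure_display} {X : metricMeasurableType R d}.
Variable mu : {measure set X -> \bar R}.
Variables (p : R) (q : \bar R).
Hypotheses (p_gt1 : 1 < p) (q_ge1 : (1 <= q)%E).

Let p_gt0 : 0 < p. Proof. exact: lt_trans p_gt1. Qed.

Definition is_lorentz_norm (N : (X -> R) -> \bar R) : Prop :=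
  N = lorentz_norm mu p q \/ N = lorentz_maximal_norm mu p q.

(** If the bound failed, the rearrangement would be at least [l] on an interval []0, t0[] with
    [t0 > (C * M / l) ^ p], and so would its averages; [lorentz_functional_ge] then gives
    [l * t0 ^ (1 / p) <= C * M], a contradiction. *)
Lemma lorentz_weak_type (N : (X -> R) -> \bar R) : is_lorentz_norm N ->
  exists2 C : R, 0 < C & forall (f : X -> R) (M l : R),
    measurable_fun [set: X] f -> 0 < M -> 0 < l -> (N f <= M%:E)%E ->
    (distribution_function mu f l <= ((C * M / l) `^ p)%:E)%E.
Proof.
move=> N_norm; have [C C0 CN] := lorentz_functional_ge p_gt1 q_ge1.
exists C => // f M l mf M0 l0 NfM; rewrite leNgt; apply/negP => lt_distr.
(* Choosing [t0] strictly in between also covers an infinite distribution function. *)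
have [t0 lt_t0 t0_distr] : exists2 t0 : R, (C * M / l) `^ p < t0 &
    (t0%:E < distribution_function mu f l)%E.
  move: lt_distr; case: (distribution_function mu f l) => [s| |]//.
    rewrite lte_fin => lts; exists (((C * M / l) `^ p + s) / 2).
      by rewrite midf_lt.
    by rewrite lte_fin midf_lt.
  by move=> _; exists ((C * M / l) `^ p + 1); rewrite ?ltrDl ?ltry.
have t00 : 0 < t0 by rewrite (le_lt_trans _ lt_t0)// powR_ge0.
have lf t : t < t0 -> (l%:E <= rearrangement mu f t)%E.
  by move=> tt0; apply: rearrangement_ge => //; exact: lt_trans t0_distr.
have : ((l * t0 `^ p^-1)%:E <= C%:E * N f)%E.
  case: N_norm => ->; apply: CN => //; [exact: ltW| | |exact: ltW| |].
  - by move=> t _; exact: rearrangement_ge0.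
  - by move=> t /andP[_ /lf].
  - exact: maximal_rearrangement_ge0.
  - move=> t /andP[t_gt0 tt0]; apply: maximal_rearrangement_ge => // [|s].
      exact: ltW.
    by move=> /andP[_ st]; apply: lf; exact: le_lt_trans tt0.
move=> /le_trans; move=> /(_ (C * M)%:E); rewrite EFinM lee_pmul2l//.
move=> /(_ NfM); rewrite -EFinM lee_fin mulrC -ler_pdivlMr// leNgt => /negP;
  apply.
have CMl0 : 0 <= C * M / l by rewrite !mulr_ge0 ?invr_ge0 ?ltW.
rewrite -[ltLHS](powRr1 CMl0) -(mulfV (lt0r_neq0 p_gt0)) powRrM.
by rewrite gt0_ltr_powR ?invr_gt0 ?nnegrE ?powR_ge0// ltW.
Qed.

Lemma lorentz_norm_le_interpolation (N : (X -> R) -> \bar R) :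
  is_lorentz_norm N ->
  exists2 K : R, 0 < K & forall (f : X -> R) (a b : R),
    measurable_fun [set: X] f -> 0 < a -> 0 < b -> (forall x, `|f x| <= a) ->
    (\int[mu]_x `|f x|%:E <= b%:E)%E ->
    (N f <= (K * (a * (b / a) `^ p^-1))%:E)%E.
Proof.
move=> N_norm; have pV0 : 0 < p^-1 by rewrite invr_gt0.
have pV1 : p^-1 < 1 by rewrite invf_lt1.
(* [th > 1 / p] makes the functional finite at infinity, and [th < 1] allows averaging. *)
pose th := (p^-1 + 1) / 2.
have pth : p^-1 < th by rewrite /th midf_lt.
have th1 : th < 1 by rewrite /th midf_lt.
have th0 : 0 < th := lt_trans pV0 pth.
have th01 : 0 < 1 - th by rewrite subr_gt0.
have [K K0 KN] := lorentz_functional_le p_gt1 q_ge1 pth.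
exists (K / (1 - th)) => [|f a b mf a0 b0 fa fb]; first by rewrite divr_gt0.
have le_a t : 0 <= t -> (rearrangement mu f t <= a%:E)%E.
  by move=> t0; apply: rearrangement_le_cst => //; exact: ltW.
have le_ab t : 0 < t -> (rearrangement mu f t <= (a * (b / a / t) `^ th)%:E)%E.
  by move=> t0; apply: rearrangement_le_powR => //; rewrite th0.
(* Both norms are bounded with [c = (1 - th)^-1 * a] and [m = b / a]; the factor comes from
   averaging and, being at least 1, is harmless for the rearrangement itself. *)
have ge1_th : 1 <= (1 - th)^-1 by rewrite invf_ge1// gerBl ltW.
rewrite -mulrA [_^-1 * _]mulrA; case: N_norm => ->; apply: KN.
- by rewrite mulr_gt0// invr_gt0.
- by rewrite divr_gt0.
- by move=> t _; exact: rearrangement_ge0.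
- move=> t /ltW/le_a/le_trans; apply.
  by rewrite lee_fin ler_peMl// ltW.
- move=> t /le_ab/le_trans; apply.
  by rewrite lee_fin -[leRHS]mulrA ler_peMl// mulr_ge0 ?powR_ge0// ltW.
- by rewrite mulr_gt0// invr_gt0.
- by rewrite divr_gt0.
- exact: maximal_rearrangement_ge0.
- move=> t t0; apply: (le_trans (maximal_rearrangement_le_cst t0 le_a)).
  by rewrite lee_fin ler_peMl// ltW.
- move=> t t0; apply: maximal_rearrangement_le_powR => //; first exact: ltW.
  by rewrite divr_ge0// ltW.
Qed.

(** Both norms depend on a function only through its distribution function. This allows passing from
    the representative of a class to a concrete function. *)
Lemma lorentz_norm_ae_eq (N : (X -> R) -> \bar R) (f g : X -> R) :
  is_lorentz_norm N -> measurable_fun [set: X] f -> measurable_fun [set: X] g ->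
  f = g %[ae mu] -> N f = N g.
Proof.
move=> N_norm.
suff fg : forall f g : X -> R,
    measurable_fun [set: X] f -> measurable_fun [set: X] g ->
    f = g %[ae mu] -> forall l,
    (distribution_function mu f l <= distribution_function mu g l)%E.
  move=> mf mg fgae; have gfae := ae_eq_sym fgae.
  have rE : rearrangement mu f = rearrangement mu g.
    have dE : distribution_function mu f = distribution_function mu g.
      by apply/funext => l; apply/eqP; rewrite eq_le !fg.
    by rewrite /rearrangement dE.
  case: N_norm => ->; first by rewrite /lorentz_norm rE.
  rewrite /lorentz_maximal_norm; congr lorentz_functional.
  by apply/funext => t; rewrite /maximal_rearrangement rE.
move=> {}f {}g mf mg [Z [mZ Z0 fgZ]] l.
rewrite -[leRHS]adde0 -Z0.
apply: le_trans (measureU2 _ _ mZ) => //; last exact: measurable_superlevel.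
apply: le_measure; rewrite ?inE; [exact: measurable_superlevel| |].
  by apply: measurableU => //; exact: measurable_superlevel.
move=> x /= lfx; have [Zx|nZx] := pselect (Z x); [by right|left].
have : [set x | [set: X] x -> f x = g x] x.
  by apply: contrapT => /fgZ.
by move=> /(_ Logic.I) <-.
Qed.

Let geometric_sum_le (x : R) n : 0 < x < 1 ->
  \sum_(0 <= k < n) x ^+ k <= (1 - x)^-1.
Proof.
move=> /andP[x0 x1]; have x1' : 0 < 1 - x by rewrite subr_gt0.
elim: n => [|n IH]; first by rewrite big_geq// invr_ge0 ltW.
rewrite big_nat_recl// expr0; under eq_bigr do rewrite exprS.
rewrite -big_distrr/= (@le_trans _ _ (1 + x * (1 - x)^-1))//.
  by rewrite lerD2l ler_pM2l.
by rewrite le_eqVlt; apply/orP; left; apply/eqP; field; rewrite gt_eqF.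
Qed.

(* Dyadic layer cake: [|f| <= l + \sum_k 2^(k+1) l 1_{|f| > 2^k l}]. *)
Let le_dyadic_series (f : X -> R) (l : R) (x : X) : 0 < l ->
  (`|f x|%:E <= l%:E + \sum_(0 <= k <oo)
    ((2 ^+ k.+1 * l) * \1_[set x | (2 ^+ k * l < `|f x|)%R] x)%:E)%E.
Proof.
move=> l0; pose u k := ((2 ^+ k.+1 * l) * \1_[set x | 2 ^+ k * l < `|f x|]
  x)%:E.
have u0 k : (0 <= u k)%E.
  by rewrite lee_fin mulr_ge0// mulr_ge0 ?exprn_ge0// ltW.
have [fl|lf] := leP `|f x| l.
  apply: (@le_trans _ _ l%:E); first by rewrite lee_fin.
  by rewrite leeDl//; apply: nneseries_ge0 => n _ _; exact: u0.
have ex_k : exists k, `|f x| <= 2 ^+ k.+1 * l.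
  exists (Num.truncn (`|f x| / l)); rewrite -ler_pdivrMr//.
  rewrite (le_trans (ltW (truncnS_gt _)))// -natrX ler_nat ltnW//.
  exact: ltn_expl.
(* For the least such [k] also [2 ^ k * l < |f x|], so the [k]-th term alone dominates [|f x|]. *)
have [k fk kmin] := ex_minnP ex_k.
have kf : 2 ^+ k * l < `|f x|.
  case: k fk kmin => [|k] fk kmin; first by rewrite expr0 mul1r.
  by rewrite ltNge; apply/negP => /kmin; rewrite ltnn.
rewrite (@nneseriesD1 _ u k xpredT)// addeC -addeA.
have -> : u k = (2 ^+ k.+1 * l)%:E by rewrite /u indicE mem_set//= mulr1.
apply: (@le_trans _ _ (2 ^+ k.+1 * l)%:E); first by rewrite lee_fin.
by rewrite leeDl// adde_ge0 ?lee_fin ?(ltW l0)//; apply: nneseries_ge0 => n _ _;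
  exact: u0.
Qed.

Let powR2_01 : 0 < (2 : R) `^ (1 - p) < 1.
Proof.
rewrite powR_gt0//= -[ltRHS](powRr0 2) /powR gt_eqF// ltr_expR.
by rewrite ltr_pM2r ?ln_gt0 ?ltr1n// subr_lt0.
Qed.

(** Integrate the dyadic bound over [E]: the [k]-th term is at most [2 * D ^ p * l ^ (1 - p) * 2 ^
    ((1 - p) * k)], a geometric series since [p > 1]. *)
Lemma integral_le_weak_type (f : X -> R) (D l : R) (E : set X) :
  measurable_fun [set: X] f -> measurable E -> 0 < D -> 0 < l ->
  (forall s, 0 < s -> (distribution_function mu f s <= ((D / s) `^ p)%:E)%E) ->
  (\int[mu]_(x in E) `|f x|%:E <= l%:E * mu E +
    (2 / (1 - 2 `^ (1 - p)) * D `^ p * l `^ (1 - p))%:E)%E.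
Proof.
move=> mf mE D0 l0 fD.
pose A k := [set x | 2 ^+ k * l < `|f x|].
have mA k : measurable (A k) by exact: measurable_superlevel.
have l2 k : 0 < 2 ^+ k * l by rewrite mulr_gt0// exprn_gt0.
pose u k (x : X) := ((2 ^+ k.+1 * l) * \1_(A k) x)%:E.
have u0 k x : (0 <= u k x)%E by rewrite lee_fin mulr_ge0// ltW.
have mu_ k : measurable_fun E (u k).
  by apply/measurable_EFinP/measurable_funM => //; exact: measurable_funTS.
apply: (@le_trans _ _ (\int[mu]_(x in E)
  (cst l%:E x + \sum_(0 <= k <oo) u k x))%E).
  by apply: ge0_le_integralW => x _; [rewrite lee_fin|exact: le_dyadic_series].
rewrite ge0_integralD//; first last.
- exact: ge0_emeasurable_sum.
- by move=> x _; apply: nneseries_ge0.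
- by move=> x _; rewrite lee_fin ltW.
rewrite integral_cst//; apply: leeD => //.
rewrite integral_nneseries//.
pose r := 2 `^ (1 - p).
have r01 : 0 < r < 1 := powR2_01.
apply: lime_le.
  by apply: is_cvg_nneseries => n _ _; apply: integral_ge0.
apply: nearW => n; apply: (@le_trans _ _
    (2 * D `^ p * l `^ (1 - p) * \sum_(0 <= k < n) r ^+ k)%:E).
  rewrite big_distrr/= -sumEFin; apply: lee_sum => k _.
  rewrite /u; under eq_integral do rewrite EFinM.
  rewrite ge0_integralZl ?lee_fin ?(ltW (l2 _))//; first last.
  - by apply/measurable_EFinP; exact: measurable_funTS.
  rewrite integral_indic//.
  apply: (@le_trans _ _ ((2 ^+ k.+1 * l)%:E * ((D / (2 ^+ k * l)) `^ p)%:E)%E).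
    rewrite lee_pmul2l ?lte_fin//; apply: le_trans (fD _ (l2 k)).
    apply: le_measure; rewrite ?inE//; first exact: measurableI.
    exact: measurable_superlevel.
  rewrite -EFinM lee_fin le_eqVlt; apply/orP; left; apply/eqP.
  have -> : r ^+ k = (2 ^+ k) `^ (1 - p).
    by rewrite -!powR_mulrn ?powR_ge0// -!powRrM mulrC.
  rewrite powRM ?invr_ge0 ?(ltW D0) ?(ltW (l2 k))//.
  rewrite -powR_inv1 ?(ltW (l2 k))// -powRrM mulN1r.
  rewrite exprS -mulrA mulrACA
    [_ * _ `^ (- p)](_ : _ = (2 ^+ k * l) `^ (1 - p)).
    by rewrite powRM ?exprn_ge0 ?(ltW l0)//; ring.
  by rewrite powRD ?powRr1 ?(ltW (l2 k))// (gt_eqF (l2 k)) implybT.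
rewrite lee_fin [leRHS](_ : _ = 2 * D `^ p * l `^ (1 - p) * (1 - r)^-1);
  last first.
  by rewrite /r; ring.
by rewrite ler_wpM2l ?mulr_ge0 ?powR_ge0//; exact: geometric_sum_le.
Qed.

(** The level [l] stays free: each use picks it to balance the measure of [E] against the tail
    term. *)
Lemma integral_le_lorentz_norm (N : (X -> R) -> \bar R) :
  is_lorentz_norm N ->
  exists2 C : R, 0 < C & forall (f : X -> R) (M l : R) (E : set X),
    measurable_fun [set: X] f -> measurable E -> 0 < M -> 0 < l ->
    (N f <= M%:E)%E ->
    (\int[mu]_(x in E) `|f x|%:E <= l%:E * mu E +
      (C * (M `^ p * l `^ (1 - p)))%:E)%E.
Proof.
move=> /lorentz_weak_type[C C0 CN].
have r1 : 0 < 1 - 2 `^ (1 - p) by rewrite subr_gt0; case/andP: powR2_01.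
exists (2 / (1 - 2 `^ (1 - p)) * C `^ p) => [|f M l E mf mE M0 l0 NfM].
  by rewrite mulr_gt0 ?powR_gt0 ?divr_gt0.
have := @integral_le_weak_type f (C * M) l E mf mE.
rewrite mulr_gt0// => /(_ isT l0) H.
rewrite (powRM _ (ltW C0) (ltW M0)) in H.
rewrite [X in (_ <= _ + X%:E)%E](_ : _ =
  2 / (1 - 2 `^ (1 - p)) * (C `^ p * M `^ p) * l `^ (1 - p)); last by ring.
by apply: H => s s0; exact: CN.
Qed.

End lorentz_norm_estimates.

(** * Lorentz spaces and balls *)

Section lorentz_space_theory.
Context {R : realType} {d : measure_display} {X : metricMeasurableType R d}.
Variable mu : {measure set X -> \bar R}.
Variables (p : R) (q : \bar R).
Hypotheses (p_gt1 : 1 < p) (q_ge1 : (1 <= q)%E).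
Variable N : (X -> R) -> \bar R.

Local Notation L := (lorentz_space mu p q N).

Lemma lorentz_fun_measurable (f : L) : measurable_fun [set: X] (f : X -> R).
Proof. exact: measurable_funPT. Qed.

Lemma lorentz_space_eq (f g : L) : (f : X -> R) = g %[ae mu] -> f = g.
Proof.
case: f g => [f Nf] [g Ng] fg.
have fgE : f = g.
  by apply/eqP; rewrite -[f]reprK -[g]reprK; exact/ae_eqP.
by case: _ / fgE Ng {fg} => Ng; rewrite (bool_irrelevance Nf Ng).
Qed.

(** The representative of the class of [g] need not be [g], hence the equality almost everywhere in
    the conclusion. *)
Lemma lorentz_space_class (g : X -> R) : measurable_fun [set: X] g ->
  (lorentz_norm mu p q g < +oo)%E -> exists f : L, (f : X -> R) = g %[ae mu].
Proof.
move=> mg Ng.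
pose G : {mfun X >-> R} := mfun_Sub (mem_set mg).
pose c : {mfun_ mu, X >-> R} := (\pi_({mfun_ mu, X >-> R}) G)%qT.
have cG : (c : X -> R) = g %[ae mu].
  by have /eqquotP/asboolP := reprK c.
have Nc : (lorentz_norm mu p q c < +oo)%E.
  by rewrite (@lorentz_norm_ae_eq _ _ _ mu p q _ _ g)//; left.
by exists (exist _ c Nc).
Qed.

Lemma lorentz_norm_ge0 (g : X -> R) : (0 <= lorentz_norm mu p q g)%E.
Proof.
rewrite /lorentz_norm /lorentz_functional; case: q => [s| |]//.
  exact: poweR_ge0.
apply: le_trans (ereal_sup_ubound _); last first.
  by exists 1 => //; rewrite /= in_itv/= ltr01.
by rewrite mule_ge0 ?lee_fin ?powR_ge0 ?rearrangement_ge0.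
Qed.

Lemma lorentz_space_integrable (f : L) (E : set X) : measurable E ->
  (mu E < +oo)%E -> mu.-integrable E (EFin \o (f : X -> R)).
Proof.
move=> mE Eoo; have mf := lorentz_fun_measurable f.
have [C C0 CN] := integral_le_lorentz_norm p_gt1 q_ge1
  (or_introl erefl : is_lorentz_norm mu p q (lorentz_norm mu p q)).
apply/integrableP; split.
  by apply/measurable_EFinP; exact: measurable_funTS.
have Nf0 := lorentz_norm_ge0 f.
have Nfoo : (lorentz_norm mu p q f < +oo)%E := svalP f.
(* Adding 1 makes the bound positive even when the norm is 0. *)
pose M := fine (lorentz_norm mu p q f) + 1.
have M0 : 0 < M by rewrite ltr_wpDl// fine_ge0.
have NM : (lorentz_norm mu p q f <= M%:E)%E.
  rewrite /M EFinD fineK ?leeDl ?lee_fin//.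
  by rewrite fin_numElt Nfoo (lt_le_trans _ Nf0).
apply: le_lt_trans (CN _ _ _ _ mf mE M0 ltr01 NM) _.
by rewrite mul1e lte_add_pinfty// ltry.
Qed.

End lorentz_space_theory.

(** * Measurability of balls and of continuous functions *)

Section metric_measure_geometry.
Context {R : realType} {d : measure_display} {X : metricMeasurableType R d}.
Variable mu : {measure set X -> \bar R}.
Hypothesis open_measurable : forall U : set X, open U -> measurable U.

Lemma measurable_cball (x : X) (s : R) : measurable (cball x s).
Proof.
rewrite -[cball x s]setCK; apply: measurableC; apply: open_measurable.
rewrite openE => y; rewrite /cball /= => /negP; rewrite -ltNge => sxy.
apply/nbhs_ballP; exists (mdist x y - s) => /=; first by rewrite subr_gt0.
move=> z; rewrite ballEmdist/= => yz; apply/negP; rewrite -ltNge.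
have := metric_triangle x z y; rewrite (metric_sym z y).
by move: yz; lra.
Qed.

Lemma measurable_continuous (g : X -> R) : continuous g ->
  measurable_fun [set: X] g.
Proof.
move=> cg; apply: (measurability _ (RGenOInfty.measurableE R)) => //.
move=> _ [_ [a ->] <-]; rewrite setTI; apply: open_measurable.
by apply: open_comp => // x _; exact: cg.
Qed.

End metric_measure_geometry.

(** * Unbounded spaces *)

Section averaging_unbounded.
Context {R : realType} {d : measure_display} {X : metricMeasurableType R d}.
Variable mu : {measure set X -> \bar R}.
Variables (p : R) (q : \bar R) (r : R).
Hypotheses (p_gt1 : 1 < p) (q_ge1 : (1 <= q)%E) (r_gt0 : 0 < r).
Hypothesis open_measurable : forall U : set X, open U -> measurable U.
Hypothesis ball_gt0_ltoo : forall (x : X) (s : R), 0 < s ->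
  (0 < mu (cball x s) < +oo)%E.

Let p_gt0 : 0 < p. Proof. exact: lt_trans p_gt1. Qed.

Lemma Rintegral_ae_cst (g : X -> R) (D : set X) (c : R) : measurable D ->
  measurable_fun [set: X] g -> {ae mu, forall x, D x -> g x = c} ->
  \int[mu]_(x in D) g x = c * fine (mu D).
Proof.
move=> mD mg gc; rewrite -Rintegral_cst// /Rintegral; congr fine.
apply: ae_eq_integral => //.
  by apply/measurable_EFinP; exact: measurable_funTS.
by apply: filterS gc => x /= gc Dx; rewrite gc.
Qed.

Lemma fine_cball_gt0 (x : X) (s : R) : 0 < s -> 0 < fine (mu (cball x s)).
Proof. by move=> s0; apply: fine_gt0; exact: ball_gt0_ltoo. Qed.

Lemma fineK_cball (x : X) (s : R) : 0 < s ->
  (fine (mu (cball x s)))%:E = mu (cball x s).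
Proof.
by move=> s0; rewrite fineK// ge0_fin_numE//; case/andP: (ball_gt0_ltoo x s0).
Qed.

(** Each point is taken more than [4 * r] farther from a base point than the previous one; the
    triangle inequality then separates any two of them. *)
Lemma unbounded_separated : ~ bounded_space X ->
  exists xs : nat -> X, forall i j, (i < j)%N -> 4 * r < mdist (xs i) (xs j).
Proof.
move=> unb; have [x0 _] : exists x0 : X, True.
  by apply: contrapT => noX; apply: unb; exists 0 => x; case: noX; exists x.
have step y : exists z, mdist x0 y + 4 * r < mdist x0 z.
  apply: contrapT => /forallNP far; apply: unb.
  exists (2 * (mdist x0 y + 4 * r)) => u v.
  have := metric_triangle u x0 v; rewrite (metric_sym u x0).
  have /negP := far u; have /negP := far v; rewrite -!leNgt.
  lra.
have [nxt nxtP] := choice step.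
exists (fun n => iter n nxt x0) => i j ij.
have incr k : mdist x0 (iter i nxt x0) + 4 * r < mdist x0
  (iter (i + k).+1 nxt x0).
  elim: k => [|k IH]; first by rewrite addn0 /=; exact: nxtP.
  by rewrite addnS /=; apply: lt_trans (nxtP _);
    rewrite ltr_wpDr// mulr_ge0 ?ltW.
have := incr (j - i.+1)%N; rewrite -addSn subnKC//.
have := metric_triangle x0 (iter i nxt x0) (iter j nxt x0).
lra.
Qed.

Variable N : (X -> R) -> \bar R.
Hypothesis N_norm : is_lorentz_norm mu p q N.
Local Notation L := (lorentz_space mu p q N).

(** The weight [mu (B) ^ (1 / p - 1)] offsets the growth of the integral over a ball [B] under a
    norm bound, which makes the Lipschitz constant independent of the ball. *)
Lemma integral_cball_lipschitz : exists2 C : R, 0 < C &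
  forall (g h : L) (x : X) (e : R), 0 < e ->
    (N (fun y => g y - h y)%R <= e%:E)%E ->
    fine (mu (cball x r)) `^ (p^-1 - 1) *
    `|\int[mu]_(y in cball x r) g y - \int[mu]_(y in cball x r) h y| <= C * e.
Proof.
have [C C0 CN] := integral_le_lorentz_norm p_gt1 q_ge1 N_norm.
exists (1 + C) => [|g h x e e0 Ngh]; first by rewrite addr_gt0.
have mB := measurable_cball open_measurable x r.
have Boo : (mu (cball x r) < +oo)%E by case/andP: (ball_gt0_ltoo x r_gt0).
have ig := lorentz_space_integrable p_gt1 q_ge1 g mB Boo.
have ih := lorentz_space_integrable p_gt1 q_ge1 h mB Boo.
rewrite -RintegralB//; set m := fine _.
have m0 : 0 < m by exact: fine_cball_gt0.
have mgh : measurable_fun [set: X] (fun y => g y - h y).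
  by apply: measurable_funB; exact: lorentz_fun_measurable.
have le1 : `|\int[mu]_(y in cball x r) (g y - h y)| <=
    e * m `^ (- p^-1) * m + C * (e `^ p * (e * m `^ (- p^-1)) `^ (1 - p)).
  apply: (le_trans (le_normr_Rintegral mB _)).
    by have := integrableB mB ig ih.
  rewrite -lee_fin /Rintegral fineK; last first.
    apply: integrable_fin_num => //.
    by have /integrable_abse := integrableB mB ig ih.
  (* At this level the two terms of the bound are [e * m ^ (1 - 1 / p)] and [C] times the same
     quantity. *)
  have l0 : 0 < e * m `^ (- p^-1) by rewrite mulr_gt0 ?powR_gt0.
  have := CN _ _ _ _ mgh mB e0 l0 Ngh.
  by rewrite -fineK_cball.
apply: (@le_trans _ _ (m `^ (p^-1 - 1) *
    (e * m `^ (- p^-1) * m + C * (e `^ p * (e * m `^ (- p^-1)) `^ (1 - p))))).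
  by rewrite ler_pM2l ?powR_gt0.
rewrite le_eqVlt; apply/orP; left; apply/eqP.
have mm : m `^ (p^-1 - 1) * (m `^ (- p^-1) * m) = 1.
  rewrite -[X in _ * (_ * X)]powRr1 ?(ltW m0)// -!powRD ?(gt_eqF m0) ?implybT//.
  by rewrite (_ : _ + _ = 0) ?powRr0//; ring.
have em : e `^ p * (e * m `^ (- p^-1)) `^ (1 - p) = e * (m `^ (- p^-1) * m).
  rewrite powRM ?powR_ge0 ?(ltW e0)// mulrA -powRD ?(gt_eqF e0) ?implybT//.
  rewrite (_ : p + (1 - p) = 1) ?powRr1 ?(ltW e0)//; last by ring.
  rewrite -[X in _ = _ * (_ * X)]powRr1 ?(ltW m0)//.
  rewrite -powRrM -powRD ?(gt_eqF m0) ?implybT//.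
  congr (_ * _ `^ _); field; rewrite gt_eqF//.
rewrite em -[RHS]mulr1 -[X in _ = _ * X]mm.
by ring.
Qed.

Lemma average_compact_bounded : doubling mu r ->
  averaging_operator_compact mu p q N r -> bounded_space X.
Proof.
move=> [gamma gamma1 mu_gamma] [T avgT cT]; apply: contrapT.
move=> /unbounded_separated[xs sep].
have gamma0 : 0 < gamma by exact: lt_le_trans gamma1.
have r2_gt0 : 0 < 2 * r by rewrite mulr_gt0.
pose B i := cball (xs i) r; pose F i := cball (xs i) (2 * r).
pose mB i := fine (mu (B i)); pose mF i := fine (mu (F i)).
have mB0 i : 0 < mB i by exact: fine_cball_gt0.
have mF0 i : 0 < mF i by exact: fine_cball_gt0.
have measB i : measurable (B i) by exact: measurable_cball.
have measF i : measurable (F i) by exact: measurable_cball.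
(* This height makes the interpolation bound for [a i] times the indicator of [F i] independent of
   [i]. *)
pose a i := mF i `^ (- p^-1).
have a0 i : 0 < a i by rewrite powR_gt0.
pose phi i (x : X) := a i * \1_(F i) x.
have mphi i : measurable_fun [set: X] (phi i).
  by apply: measurable_funM => //; exact: measurable_indic.
have norm_phi i x : `|phi i x| = phi i x.
  by rewrite ger0_norm// mulr_ge0// ltW.
have phi_le i x : `|phi i x| <= a i.
  rewrite norm_phi; apply: ler_piMr; first exact: ltW.
  by rewrite indicE; case: (x \in F i).
have int_phi i : (\int[mu]_x `|phi i x|%:E <= (a i * mF i)%:E)%E.
  under eq_integral do rewrite norm_phi /phi EFinM.
  rewrite ge0_integralZl ?lee_fin ?(ltW (a0 i))//; last first.
    by apply/measurable_EFinP; exact: measurable_indic.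
  by rewrite integral_indic// setIT EFinM /mF fineK_cball.
have amF i : a i * (a i * mF i / a i) `^ p^-1 = 1.
  rewrite [a i * mF i]mulrC mulfK ?gt_eqF// /a -powRD; last first.
    by rewrite (gt_eqF (mF0 i)) implybT.
  by rewrite addNr powRr0.
have amF0 i : 0 < a i * mF i by rewrite mulr_gt0.
(* Stated for either norm: membership in the space is measured by [lorentz_norm], boundedness of the
   family by [N]. *)
have norm_le1 M : is_lorentz_norm mu p q M ->
    exists K : R, forall i, (M (phi i) <= K%:E)%E.
  move=> /(lorentz_norm_le_interpolation p_gt1 q_ge1)[K _ MK].
  exists K => i; have := MK _ _ _ (mphi i) (a0 i) (amF0 i) (phi_le i)
    (int_phi i).
  by rewrite amF mulr1.
have [f fphi] : exists f : nat -> L, forall i, (f i : X -> R) = phi i %[ae mu].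
  suff /choice[f fphi] i : exists h : L, (h : X -> R) = phi i %[ae mu].
    by exists f.
  apply: lorentz_space_class; first exact: mphi.
  have [K phiK] := norm_le1 _ (or_introl erefl : is_lorentz_norm mu p q
    (lorentz_norm mu p q)).
  by apply: le_lt_trans (phiK i) _; rewrite ltry.
have [K NK] := norm_le1 _ N_norm.
have f_bounded : lorentz_bounded (range f).
  exists K => _ [i _ <-].
  by rewrite (lorentz_norm_ae_eq N_norm _ (mphi i) (fphi i))//;
    exact: lorentz_fun_measurable.
have avg_cst i j x c : B i x -> (forall y, cball x r y -> phi j y = c) ->
    average mu r (f j) x = c.
  move=> Bx phic; rewrite /average (@Rintegral_ae_cst _ _ c).
  - by rewrite mulrCA mulVf ?mulr1// gt_eqF// fine_cball_gt0.
  - exact: measurable_cball.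
  - exact: lorentz_fun_measurable.
  - by apply: filterS (fphi j) => y /= -> // /phic.
(* For [x] in [B i] the ball of radius [r] about [x] lies in [F i]. *)
have avg_ii i x : B i x -> average mu r (f i) x = a i.
  move=> Bx; apply: (avg_cst i) => // y xy;
    rewrite /phi indicE mem_set ?mulr1//.
  move: Bx xy; rewrite /B /F /cball/=.
  by have := metric_triangle (xs i) x y; lra.
(* Since the centers are more than [4 * r] apart, the ball of radius [r] about a point of [B i]
   misses [F j]. *)
have avg_ij i j x : i <> j -> B i x -> average mu r (f j) x = 0.
  move=> ij Bx; apply: (avg_cst i) => // y xy;
    rewrite /phi indicE memNset ?mulr0//.
  move: Bx xy; rewrite /B /F /cball/= => Bx xy jy.
  have ij4 : 4 * r < mdist (xs i) (xs j).
    have [ij'|ji|//] := ltngtP i j; first exact: sep.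
    by rewrite metric_sym; exact: sep.
  have := metric_triangle (xs i) x (xs j); have := metric_triangle x y (xs j).
  by rewrite (metric_sym y (xs j)); move: r_gt0; lra.
have int_T i j c : (forall x, B i x -> average mu r (f j) x = c) ->
    \int[mu]_(x in B i) T (f j) x = c * mB i.
  move=> avg_c; rewrite (@Rintegral_ae_cst _ _ c)//.
  by apply: filterS (avgT (f j)) => x /= -> /avg_c.
pose w i := mB i `^ (p^-1 - 1).
have w0 i : 0 < w i by rewrite powR_gt0.
(* Doubling at radius [r] bounds [(mB i / mF i) ^ (1 / p)], the value of the [i]-th weighted
   functional at [T (f i)], from below by [kappa]. *)
pose kappa := gamma^-1 `^ p^-1.
have kappa0 : 0 < kappa by rewrite powR_gt0// invr_gt0.
have kappa_le i : kappa <= w i * (a i * mB i).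
  have -> : w i * (a i * mB i) = (mB i / mF i) `^ p^-1.
    rewrite powRM ?invr_ge0 ?(ltW (mB0 i)) ?(ltW (mF0 i))//.
    rewrite -(powR_inv1 (ltW (mF0 i))) -powRrM mulN1r /w powRB; last first.
      by rewrite (gt_eqF (mB0 i)) implybT.
    by rewrite powRr1 ?(ltW (mB0 i))// /a; field; rewrite gt_eqF.
  apply: ge0_ler_powR; rewrite ?nnegrE ?divr_ge0 ?invr_ge0 ?(ltW p_gt0)
    ?(ltW gamma0) ?(ltW (mB0 i)) ?(ltW (mF0 i))//.
  rewrite ler_pdivlMr// mulrC ler_pdivrMr// mulrC -lee_fin EFinM.
  by rewrite /mF /mB !fineK_cball.
have [C C0 lip] := integral_cball_lipschitz.
(* Compactness yields a cluster point [h] of the sequence [T (f n)]. *)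
pose G := (T (f n) @[n --> \oo]) : set_system L.
have GE : G (closure (T @` range f)).
  by exists 0%N => // n _; apply: subset_closure; exists (f n) => //; exists n.
have [h0 [_ clh]] := cT _ f_bounded G _ GE; pose h : L := h0.
pose lam i (g : L) := w i *
  `|\int[mu]_(x in B i) g x - \int[mu]_(x in B i) h x|.
(* The slack [eta < kappa / 2], uniform in [i], is what makes [U] open: a small enough move in [N]
   changes all [lam i] by at most half of the gap. *)
pose U := [set g : L | exists2 eta : R, eta < kappa / 2 &
  forall i, lam i g <= eta].
have oU : open U.
  move=> g [eta eta_lt geta]; exists ((kappa / 2 - eta) / 2 / C).
    by rewrite !divr_gt0// subr_gt0.
  move=> g' /ltW gg'; exists ((kappa / 2 + eta) / 2).
    by move: eta_lt; lra.
  move=> i; have := lip g' g (xs i) _ _ gg'.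
  rewrite !divr_gt0 ?subr_gt0// => /(_ isT); rewrite -/(B i) -/(w i) => le1.
  apply: (@le_trans _ _ ((kappa / 2 - eta) / 2 + eta)); last by lra.
  rewrite [C * _]mulrC divfK ?gt_eqF// in le1;
    apply: le_trans (lerD le1 (geta i)).
  rewrite /lam -mulrDr ler_pM2l//.
  apply: le_trans (ler_normD _ _); rewrite le_eqVlt; apply/orP; left; apply/eqP.
  by congr (`|_|); ring.
have Uh : U h.
  exists 0; first by rewrite divr_gt0.
  by move=> i; rewrite /lam subrr normr0 mulr0.
have tail m : exists2 n, (m <= n)%N & U (T (f n)).
  have Gm : G [set g | exists2 n, (m <= n)%N & g = T (f n)].
    by exists m => // n mn; exists n.
  have [_ [[n mn ->] Un]] := clh _ _ Gm (open_nbhs_nbhs (conj oU Uh)).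
  by exists n.
(* Two terms with [i < j] lie in [U]. Their [i]-th functionals are at least [kappa] and equal to 0,
   yet both are within less than [kappa / 2] of that of [h]. *)
have [i _ [e1 e1k Ue1]] := tail 0%N; have [j ij [e2 e2k Ue2]] := tail i.+1.
have := lerD (Ue1 i) (Ue2 i); rewrite /lam -mulrDr.
rewrite (int_T i i (a i))//; last exact: avg_ii.
rewrite (int_T i j 0); last first.
  by move=> x; apply: avg_ij => ji; rewrite ji ltnn in ij.
rewrite mul0r sub0r normrN => le12.
have : w i * (a i * mB i) <= e1 + e2.
  apply: le_trans le12; rewrite ler_pM2l//; set I := Rintegral _ _ _.
  rewrite (_ : a i * mB i = (a i * mB i - I) + I); last by rewrite subrK.
  apply: (le_trans (ler_norm _)); apply: le_trans (ler_normD _ _) _.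
  by rewrite subrK.
by move: (kappa_le i) e1k e2k; lra.
Qed.

End averaging_unbounded.

(** * Bounded spaces *)

Section bounded_geometry.
Context {R : realType} {d : measure_display} {X : metricMeasurableType R d}.
Variable mu : {measure set X -> \bar R}.
Variable r : R.
Hypothesis r_gt0 : 0 < r.
Hypothesis open_measurable : forall U : set X, open U -> measurable U.
Hypothesis ball_gt0_ltoo : forall (x : X) (s : R), 0 < s ->
  (0 < mu (cball x s) < +oo)%E.

Lemma doubling_iter (k : nat) : (forall s : R, r <= s -> doubling mu s) ->
  exists2 G : R, 0 < G &
    forall x : X, (mu (cball x (2 ^+ k * r)) <= G%:E * mu (cball x r))%E.
Proof.
move=> dbl; elim: k => [|k [G G0 IH]].
  by exists 1 => // x; rewrite expr0 mul1r mul1e.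
have [g g1 gP] : doubling mu (2 ^+ k * r).
  by apply: dbl; rewrite ler_peMl ?(ltW r_gt0)// exprn_ege1// ler1n.
have g0 : 0 < g by exact: lt_le_trans g1.
exists (g * G) => [|x]; first by rewrite mulr_gt0.
rewrite exprS -mulrA EFinM -muleA; apply: (le_trans (gP x)).
by rewrite lee_pmul2l.
Qed.

(** Once [2 ^ k * r] exceeds the diameter, every ball of that radius is the whole space, and
    iterated doubling compares its measure with that of each ball of radius [r]. *)
Lemma bounded_space_measure : (forall s : R, r <= s -> doubling mu s) ->
  bounded_space X ->
  exists V c : R, [/\ 0 < V, 0 < c, (mu [set: X] <= V%:E)%E &
    forall x : X, c <= fine (mu (cball x r))].
Proof.
move=> dbl [D Dbound].
(* On the empty space any positive constants will do. *)
have [[x0 _]|noX] := pselect (exists x0 : X, True); last first.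
  exists 1, 1; split => // [|x]; last by case: noX; exists x.
  rewrite (_ : [set: X] = set0) ?measure0 ?lee_fin//.
  by rewrite -subset0 => x _; apply: noX; exists x.
pose k := (Num.truncn (D / r)).+1.
have cballT x : cball x (2 ^+ k * r) = [set: X].
  apply/seteqP; split => // y _; rewrite /cball/=.
  apply: (le_trans (Dbound x y)); rewrite -ler_pdivrMr//.
  rewrite (le_trans (ltW (truncnS_gt _)))// -natrX ler_nat ltnW//.
  exact: ltn_expl.
have kr0 : 0 < 2 ^+ k * r by rewrite mulr_gt0 ?exprn_gt0.
have VE : (fine (mu [set: X]))%:E = mu [set: X].
  by rewrite -(cballT x0) fineK_cball.
have V0 : 0 < fine (mu [set: X]) by rewrite -(cballT x0) fine_cball_gt0.
have [G G0 GP] := doubling_iter k dbl.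
exists (fine (mu [set: X])), (fine (mu [set: X]) / G); split => //.
- by rewrite divr_gt0.
- by rewrite VE.
- move=> x; rewrite ler_pdivrMr// mulrC -lee_fin EFinM VE fineK_cball//.
  by rewrite -(cballT x).
Qed.

(* The Vitali covering property is what makes up for the lack of total
   boundedness: up to a set of small measure, finitely many prescribed balls
   cover the space. *)
Lemma vitali_finite_cover (rho : X -> R) (eta : R) :
  vitali_covering_property mu -> (mu [set: X] < +oo)%E ->
  (forall x, 0 < rho x) -> 0 < eta ->
  exists s : seq X,
    (mu (~` \bigcup_(x in [set` s]) cball x (rho x)) <= eta%:E)%E.
Proof.
move=> vitali muT rho0 eta0.
(* The bound 1 makes the radii uniformly bounded, and the bound [rho x] puts each ball inside the
   prescribed one; all smaller positive radii are allowed. *)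
pose Bs := [set b | exists x s, [/\ 0 < s, s <= 1, s <= rho x & b = cball x s]].
have [||B' [B'B cB' _ B'0]] := vitali [set: X] Bs.
- by exists 1 => _ [x [s [s0 s1 _ ->]]]; exists x, s.
- move=> x _; have m0 : 0 < Num.min 1 (rho x) by rewrite lt_min ltr01 rho0.
  have Bsm s : 0 < s -> s <= Num.min 1 (rho x) -> Bs (cball x s).
    by move=> s0; rewrite le_min => /andP[? ?]; exists x, s.
  split; first by exists (Num.min 1 (rho x)) => //; exact: Bsm.
  have lb0 : lbound [set s | 0 < s /\ Bs (cball x s)] 0 by move=> s [/ltW].
  apply/eqP; rewrite eq_le; apply/andP; split; last first.
    apply: lb_le_inf => //; exists (Num.min 1 (rho x)).
    by split => //; exact: Bsm.
  apply/ler_addgt0Pl => e e0; rewrite addr0.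
  apply: (@le_trans _ _ (Num.min e (Num.min 1 (rho x))));
    last by rewrite ge_min lexx.
  apply: ge_inf; first by exists 0.
  have me0 : 0 < Num.min e (Num.min 1 (rho x)) by rewrite lt_min e0.
  by split => //; apply: Bsm => //; rewrite ge_min lexx orbT.
have [enumB enumBP] := pcard_surjP cB'.
(* A ball of [B'] is a bare set, so a center is chosen for it; the list is empty when the
   enumeration leaves [B']. *)
have /choice[ctr ctrP] i : exists l : seq X, B' (enumB i) ->
    exists2 x, x \in l & enumB i `<=` cball x (rho x).
  have [Bi|nBi] := pselect (B' (enumB i)); last by exists [::].
  have [x [s [_ _ sx ->]]] := B'B _ Bi.
  by exists [:: x] => _; exists x; [rewrite inE|move=> y /le_trans; apply].
pose pts n := flatten [seq ctr i | i <- iota 0 n].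
pose F n := ~` \bigcup_(x in [set` pts n]) cball x (rho x).
have mF n : measurable (F n).
  apply: measurableC; apply: fin_bigcup_measurable; first exact: finite_seq.
  by move=> x _; exact: measurable_cball.
have mcapF : measurable (\bigcap_n F n) by exact: bigcapT_measurable.
(* A point outside all the finite unions lies in no ball of [B'], so the intersection is inside the
   null set left by the Vitali property. Continuity from above then makes some [F n] small. *)
have muF0 : mu (\bigcap_n F n) = 0%E.
  apply/eqP; rewrite eq_le measure_ge0 andbT -measurable_mu_extE// -B'0.
  apply: le_mu_ext => y Fy; split => // -[b B'b yb].
  have [i _ bi] := enumBP _ B'b; rewrite -bi in B'b yb.
  have [x xl yx] := ctrP _ B'b; apply: (Fy i.+1 I); exists x; last exact: yx.
  by apply/flattenP; exists (ctr i) => //; apply: map_f;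
    rewrite mem_iota/= add0n.
have niF : nonincreasing_seq F.
  move=> m n mn; apply/subsetPset => y Fny [x xm yx]; apply: Fny;
    exists x => //.
  move: xm => /flattenP[_ /mapP[i + ->] xi]; rewrite mem_iota/= => im.
  apply/flattenP; exists (ctr i) => //; apply: map_f; rewrite mem_iota/=.
  exact: leq_trans im _.
have F0oo : (mu (F 0%N) < +oo)%E.
  by apply: le_lt_trans muT; apply: le_measure; rewrite ?inE.
have := nonincreasing_cvg_mu F0oo mF mcapF niF; rewrite muF0 => cvgF.
have /cvgF[n _ /(_ n (leqnn n))] : nbhs 0%E [set y : \bar R | (y < eta%:E)%E].
  by apply: open_nbhs_nbhs; split;
    [exact: open_ereal_lt_ereal|rewrite /= lte_fin].
by move=> /ltW; exists (pts n).
Qed.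

End bounded_geometry.

(** * Boundedness and equicontinuity of the averages *)

Section averages_equicontinuous.
Context {R : realType} {d : measure_display} {X : metricMeasurableType R d}.
Variable mu : {measure set X -> \bar R}.
Variables (p : R) (q : \bar R) (r : R).
Hypotheses (p_gt1 : 1 < p) (q_ge1 : (1 <= q)%E) (r_gt0 : 0 < r).
Hypothesis open_measurable : forall U : set X, open U -> measurable U.
Hypothesis ball_gt0_ltoo : forall (x : X) (s : R), 0 < s ->
  (0 < mu (cball x s) < +oo)%E.
Hypothesis ball_continuity : forall x : X,
  mu (cball x r `+` cball y r) @[y --> x] --> 0%E.

(** The restrictions of [f] to [A] and [B] differ only on the symmetric difference. Besides two
    balls, this serves with [B] empty and with [f] constant equal to 1. *)
Lemma Rintegral_dist_le (f : X -> R) (A B : set X) :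
  mu.-integrable [set: X] (EFin \o f) -> measurable A -> measurable B ->
  ((`|\int[mu]_(x in A) f x - \int[mu]_(x in B) f x|)%:E <=
    \int[mu]_(x in A `+` B) `|f x|%:E)%E.
Proof.
move=> intf mA mB.
have int_ (D : set X) : measurable D -> mu.-integrable setT (EFin \o (f \_ D)).
  move=> mD; rewrite -restrict_EFin; apply/integrable_restrict => //.
  by apply: integrableS intf => //; exact: measurableI.
have mAB : measurable (A `+` B).
  by apply: measurableU; exact: measurableD.
rewrite (Rintegral_mkcond mu A) (Rintegral_mkcond mu B) -RintegralB//;
  [|exact: int_..].
have intAB := integrableB measurableT (int_ _ mA) (int_ _ mB).
apply: (@le_trans _ _ (\int[mu]_x `|(f \_ A) x - (f \_ B) x|%:E)%E).
  rewrite -[leRHS]fineK; last first.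
    by apply: integrable_fin_num => //; have /integrable_abse := intAB.
  by rewrite lee_fin; apply: le_normr_Rintegral.
rewrite [leRHS]integral_mkcond; apply: ge0_le_integralW => x _.
  by rewrite lee_fin.
rewrite !patchE -[@point R]/(0 : R) -[@point (\bar R)]/(0 : \bar R).
have [xA|xA] := boolP (x \in A); have [xB|xB] := boolP (x \in B).
- by rewrite subrr normr0; case: ifP; rewrite ?lee_fin.
- rewrite subr0 mem_set//; left; split; first exact: set_mem.
  by move/mem_set; rewrite (negPf xB).
- rewrite sub0r normrN mem_set//; right; split; first exact: set_mem.
  by move/mem_set; rewrite (negPf xA).
- by rewrite subrr normr0; case: ifP; rewrite ?lee_fin.
Qed.

Lemma ball_continuity_mdist (x : X) (e : R) : 0 < e ->
  exists2 rho : R, 0 < rho & forall y, mdist x y <= rho ->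
    (mu (cball x r `+` cball y r) <= e%:E)%E.
Proof.
move=> e0.
have e_nbhs : nbhs 0%E [set y : \bar R | (y < e%:E)%E].
  by apply: open_nbhs_nbhs; split;
    [exact: open_ereal_lt_ereal|rewrite /= lte_fin].
have /nbhs_ballP[s /= s0 sP] : nbhs x
    [set y | (mu (cball x r `+` cball y r) < e%:E)%E].
  exact: ball_continuity e_nbhs.
exists (s / 2); first by rewrite divr_gt0.
move=> y xy; apply: ltW; apply: (sP y); rewrite ballEmdist/=.
by apply: le_lt_trans xy _; rewrite ltr_pdivrMr// ltr_pMr// ltr1n.
Qed.

Variable N : (X -> R) -> \bar R.
Hypothesis N_norm : is_lorentz_norm mu p q N.
Variables V c : R.
Hypotheses (V_gt0 : 0 < V) (c_gt0 : 0 < c).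
Hypothesis muT_le : (mu [set: X] <= V%:E)%E.
Hypothesis ball_ge : forall x : X, c <= fine (mu (cball x r)).

Let muT_lty : (mu [set: X] < +oo)%E.
Proof. by apply: le_lt_trans muT_le _; rewrite ltry. Qed.

Let mcball (x : X) : measurable (cball x r).
Proof. exact: measurable_cball. Qed.

(** At level [l = M] both terms of the integral bound are linear in [M]. *)
Lemma integral_le_norm_bounded : exists2 C : R, 0 < C &
  forall (f : X -> R) (M : R), measurable_fun [set: X] f -> 0 < M ->
    (N f <= M%:E)%E -> (\int[mu]_x `|f x|%:E <= (C * M)%:E)%E.
Proof.
have [C C0 CN] := integral_le_lorentz_norm p_gt1 q_ge1 N_norm.
exists (V + C) => [|f M mf M0 NfM]; first by rewrite addr_gt0.
apply: (le_trans (CN _ _ _ _ mf measurableT M0 M0 NfM)).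
rewrite -powRD; last by rewrite (gt_eqF M0) implybT.
rewrite (_ : p + (1 - p) = 1); last by ring.
rewrite powRr1 ?(ltW M0)// mulrDl EFinD; apply: leeD => //.
by rewrite mulrC EFinM lee_pmul2l.
Qed.

Lemma integrable_of_norm (f : X -> R) (M : R) : measurable_fun [set: X] f ->
  0 < M -> (N f <= M%:E)%E -> mu.-integrable [set: X] (EFin \o f).
Proof.
move=> mf M0 NfM; apply/integrableP; split; first exact/measurable_EFinP.
have [C C0 CN] := integral_le_norm_bounded.
by apply: le_lt_trans (CN _ _ mf M0 NfM) _; rewrite ltry.
Qed.

Lemma average_bounded (M : R) : 0 < M -> exists2 J : R, 0 < J &
  forall (f : X -> R) (x : X), measurable_fun [set: X] f -> (N f <= M%:E)%E ->
    `|\int[mu]_(y in cball x r) f y| <= J /\ `|average mu r f x| <= J / c.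
Proof.
move=> M0; have [C C0 CN] := integral_le_norm_bounded.
exists (C * M) => [|f x mf NfM]; first by rewrite mulr_gt0.
have intf := integrable_of_norm mf M0 NfM.
have fJ : `|\int[mu]_(y in cball x r) f y| <= C * M.
  have := Rintegral_dist_le intf (mcball x) measurable0.
  rewrite Rintegral_set0 subr0 => le1; rewrite -lee_fin.
  apply: (le_trans le1); apply: le_trans (CN _ _ mf M0 NfM).
  apply: ge0_subset_integral => //; first by apply: measurableU;
    exact: measurableD.
  by apply/measurable_EFinP; exact: measurableT_comp.
have m0 : 0 < fine (mu (cball x r)) by exact: fine_cball_gt0.
split => //; rewrite /average normrM mulrC normfV (gtr0_norm m0).
by rewrite ler_pM ?invr_ge0 ?(ltW m0)// lef_pV2 ?posrE.
Qed.

Lemma average_equicontinuous (M : R) (x : X) (delta : R) : 0 < M -> 0 < delta ->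
  exists2 rho : R, 0 < rho & forall (f : X -> R) (y : X),
    measurable_fun [set: X] f -> (N f <= M%:E)%E -> mdist x y <= rho ->
    `|average mu r f x - average mu r f y| <= delta.
Proof.
move=> M0 delta0; have [J J0 JP] := average_bounded M0.
have [C C0 CN] := integral_le_lorentz_norm p_gt1 q_ge1 N_norm.
(* [e1] bounds the change of the integral and [e2] that of the measure of the ball; each contributes
   [delta / 2] after division by measures at least [c]. *)
pose e1 := delta * c / 2; pose e2 := delta * c ^+ 2 / (2 * J).
have e10 : 0 < e1 by rewrite !mulr_gt0// invr_gt0.
have e20 : 0 < e2 by rewrite !mulr_gt0 ?exprn_gt0// invr_gt0 mulr_gt0.
pose t := e1 / (2 * (C * M `^ p)).
have CM0 : 0 < C * M `^ p by rewrite mulr_gt0 ?powR_gt0.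
have t0 : 0 < t by rewrite divr_gt0// mulr_gt0.
(* This level makes the tail term [C * M ^ p * l ^ (1 - p)] equal to [e1 / 2]. It depends on neither
   [f] nor [y], so [rho] can be chosen after it. *)
pose l := t `^ (1 - p)^-1.
have l0 : 0 < l by rewrite powR_gt0.
have lE : l `^ (1 - p) = t.
  by rewrite -powRrM mulVf ?powRr1 ?(ltW t0)// lt_eqF// subr_lt0.
pose e3 := Num.min (e1 / (2 * l)) e2.
have e30 : 0 < e3 by rewrite lt_min e20 andbT divr_gt0// mulr_gt0.
have [rho rho0 rhoP] := ball_continuity_mdist x e30.
exists rho => // f y mf NfM /rhoP mu_xy.
have intf := integrable_of_norm mf M0 NfM.
have mxy : measurable (cball x r `+` cball y r).
  by apply: measurableU; exact: measurableD.
have [_ _] := (JP f x mf NfM, JP f y mf NfM).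
have [Iy_le _] := JP f y mf NfM.
rewrite /average; set Ix := Rintegral mu (cball x r) _.
set Iy := Rintegral mu (cball y r) _ in Iy_le *.
set mx := fine (mu (cball x r)); set my := fine (mu (cball y r)).
have mx0 : 0 < mx by exact: fine_cball_gt0.
have my0 : 0 < my by exact: fine_cball_gt0.
have Ixy : `|Ix - Iy| <= e1.
  rewrite -lee_fin; apply: (le_trans (Rintegral_dist_le intf _ _)) => //.
  apply: (le_trans (CN _ _ _ _ mf mxy M0 l0 NfM)).
  rewrite lE (_ : C * (M `^ p * t) = e1 / 2); last first.
    by rewrite /t; field; rewrite !gt_eqF// powR_gt0.
  rewrite [leRHS](_ : _ = (e1 / 2 + e1 / 2)%:E); last by congr EFin; lra.
  rewrite EFinD leeD2r//; apply: (@le_trans _ _ (l%:E * (e1 / (2 * l))%:E)%E).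
    rewrite lee_pmul2l//; apply: le_trans mu_xy _.
    by rewrite lee_fin /e3 ge_min lexx.
  by rewrite -EFinM lee_fin le_eqVlt; apply/orP; left; apply/eqP; field;
    rewrite gt_eqF.
have int1 : mu.-integrable [set: X] (EFin \o cst (1 : R)).
  apply/integrableP; split; first exact/measurable_EFinP.
  by under eq_integral do rewrite /= normr1; rewrite integral_cst// mul1e.
have mxy_le : `|mx - my| <= e2.
  have := Rintegral_dist_le int1 (mcball x) (mcball y).
  rewrite !Rintegral_cst// !mul1r => le1; rewrite -lee_fin.
  apply: (le_trans le1); under eq_integral do rewrite normr1.
  rewrite integral_cst// mul1e; apply: le_trans mu_xy _.
  by rewrite lee_fin /e3 ge_min lexx orbT.
have -> : mx^-1 * Ix - my^-1 * Iy =
    mx^-1 * (Ix - Iy) + (mx^-1 * my^-1) * (Iy * (my - mx)).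
  by field; rewrite !gt_eqF.
apply: (le_trans (ler_normD _ _)); rewrite !normrM.
have mxV : mx^-1 <= c^-1 by rewrite lef_pV2 ?posrE//; exact: ball_ge.
have myV : my^-1 <= c^-1 by rewrite lef_pV2 ?posrE//; exact: ball_ge.
rewrite (ger0_norm (_ : 0 <= mx^-1)) ?invr_ge0 ?(ltW mx0)//.
rewrite (ger0_norm (_ : 0 <= my^-1)) ?invr_ge0 ?(ltW my0)//.
rewrite -normrN opprB in mxy_le.
apply: (@le_trans _ _ (c^-1 * e1 + c^-1 * c^-1 * (J * e2))).
  by rewrite lerD ?ler_pM// ?mulr_ge0 ?invr_ge0 ?(ltW mx0) ?(ltW my0).
by rewrite le_eqVlt; apply/orP; left; apply/eqP; rewrite /e1 /e2; field;
  rewrite !gt_eqF.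
Qed.

End averages_equicontinuous.

(** * Compactness of equicontinuous families *)

Section equicontinuous_compact.
Context {R : realType} {d : measure_display} {X : metricMeasurableType R d}.
Variable mu : {measure set X -> \bar R}.
Variables (p : R) (q : \bar R).
Hypotheses (p_gt1 : 1 < p) (q_ge1 : (1 <= q)%E).
Hypothesis open_measurable : forall U : set X, open U -> measurable U.
Hypothesis mu_vitali : vitali_covering_property mu.
Variables (V J : R) (rho : X -> R -> R).
Hypotheses (V_gt0 : 0 < V) (J_gt0 : 0 < J).
Hypothesis muT_le : (mu [set: X] <= V%:E)%E.
Hypothesis rho_gt0 : forall x delta, 0 < delta -> 0 < rho x delta.
Variable N : (X -> R) -> \bar R.
Hypothesis N_norm : is_lorentz_norm mu p q N.
Local Notation L := (lorentz_space mu p q N).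

Let p_gt0 : 0 < p. Proof. exact: lt_trans p_gt1. Qed.

Let muT_lty : (mu [set: X] < +oo)%E.
Proof. by apply: le_lt_trans muT_le _; rewrite ltry. Qed.

(** One bound [J] and one modulus [rho] serve the whole family. The modulus depends on the point
    because ball continuity is assumed pointwise. *)
Definition equicontinuous_bounded (g : X -> R) : Prop :=
  (forall x, `|g x| <= J) /\
  forall x delta, 0 < delta -> forall y, mdist x y <= rho x delta ->
    `|g x - g y| <= delta.

Lemma equicontinuous_bounded_measurable (g : X -> R) :
  equicontinuous_bounded g -> measurable_fun [set: X] g.
Proof.
move=> [_ g_rho]; apply: measurable_continuous => // x.
apply/cvgrPdist_le => e e0; apply/nbhs_ballP.
exists (rho x e) => /=; first exact: rho_gt0.
by move=> y; rewrite ballEmdist/= => /ltW; exact: g_rho.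
Qed.

Lemma equicontinuous_L1_close (b : R) : 0 < b ->
  exists (s : seq X) (delta : R), 0 < delta /\
    forall g g', equicontinuous_bounded g -> equicontinuous_bounded g' ->
      (forall x, x \in s -> `|g x - g' x| <= delta) ->
      (\int[mu]_x `|g x - g' x|%:E <= b%:E)%E.
Proof.
(* The difference is at most [3 * delta] on the covered part and [2 * J] off it, where the measure
   is at most [eta]; the two contributions are [b / 2] each. *)
move=> b0; pose delta := b / (6 * V); pose eta := b / (4 * J).
have delta0 : 0 < delta by rewrite divr_gt0// mulr_gt0.
have eta0 : 0 < eta by rewrite divr_gt0// mulr_gt0.
have [s s_cover] := vitali_finite_cover open_measurable mu_vitali muT_lty
  (fun x => rho_gt0 x delta0) eta0.
exists s, delta; split => // g g' [gJ g_rho] [g'J g'_rho] gg'.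
set D := \bigcup_(x in [set` s]) cball x (rho x delta) in s_cover.
have mD : measurable D.
  apply: fin_bigcup_measurable; first exact: finite_seq.
  by move=> x _; exact: measurable_cball.
apply: (@le_trans _ _ (\int[mu]_x ((cst (3 * delta)%:E x) +
    (2 * J)%:E * (\1_(~` D) x)%:E))%E).
  apply: ge0_le_integralW => x _; first by rewrite lee_fin.
  rewrite -EFinM -EFinD lee_fin indicE.
  have [[z zs zx]|nDx] := pselect (D x).
    rewrite memNset; last by move=> /(_ (ex_intro2 _ _ z zs zx)).
    rewrite mulr0 addr0.
    have -> : g x - g' x = (g z - g' z) - (g z - g x) + (g' z - g' x) by ring.
    apply: (le_trans (ler_normD _ _)).
    have := ler_normB (g z - g' z) (g z - g x).
    have := g_rho z _ delta0 x zx; have := g'_rho z _ delta0 x zx.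
    have := gg' z zs; lra.
  rewrite mem_set//= mulr1; apply: (le_trans (ler_normB _ _)).
  by have := gJ x; have := g'J x; move: delta0; lra.
rewrite ge0_integralD//; first last.
- apply: measurable_funeM; apply/measurable_EFinP.
  by apply: measurable_indic; exact: measurableC.
- by move=> x _; rewrite mule_ge0// lee_fin// mulr_ge0// ltW.
- by move=> x _; rewrite lee_fin mulr_ge0// ltW.
rewrite integral_cst// ge0_integralZl ?lee_fin ?mulr_ge0 ?(ltW J_gt0)//;
  last first.
  by apply/measurable_EFinP; apply: measurable_indic; exact: measurableC.
rewrite integral_indic ?setIT//; last exact: measurableC.
rewrite [leRHS](_ : _ = ((3 * delta) * V + (2 * J) * eta)%:E); last first.
  by congr EFin; rewrite /delta /eta; field; rewrite !gt_eqF.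
rewrite EFinD; apply: leeD.
  by rewrite [leRHS]EFinM lee_pmul2l// lte_fin mulr_gt0.
by rewrite [leRHS]EFinM lee_pmul2l// lte_fin mulr_gt0.
Qed.

Lemma filter_forall_seq (T : Type) (I : eqType) (F : set_system T)
    (P : I -> set T) (s : seq I) : Filter F -> (forall i, F (P i)) ->
  F [set t | forall i, i \in s -> P i t].
Proof.
move=> FF FP; elim: s => [|i s IH]; first exact: filterE.
apply: filterS (filterI (FP i) IH) => t [Pit Pst] j.
by rewrite inE => /orP[/eqP->|/Pst].
Qed.

(** A compact interval provides a cluster point. It is a limit, since an ultrafilter contains each
    set or its complement. *)
Lemma ultra_bounded_cvg (T : Type) (F : set_system T) (u : T -> R) (a : R) :
  UltraFilter F -> F [set t | `|u t| <= a] ->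
  exists l : R, forall e, 0 < e -> F [set t | `|u t - l| <= e].
Proof.
move=> UF Fu; have FF : ProperFilter F by exact: ultra_proper.
have uF : F (u @^-1` `[- a, a]%classic).
  by apply: filterS Fu => t /=; rewrite in_itv/= -ler_norml.
have [l [_ cl]] := @segment_compact R (- a) a (u @ F) _ uF.
exists l => e e0; have [//|Fc] := in_ultra_setVsetC [set t | `|u t - l| <= e]
  UF.
have uFc : F (u @^-1` [set y | e < `|y - l|]).
  by apply: filterS Fc => t /= /negP; rewrite -ltNge.
have [y [/= ly]] := cl _ _ uFc (nbhsx_ballx l e e0).
by rewrite /ball/= distrC ltNge => /negP; rewrite ltW.
Qed.

(** Equicontinuity is asked of some function in the class, as the chosen representative may differ
    from it on a null set. *)
Definition equicontinuous_classes : set L :=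
  [set h | exists2 g : X -> R, equicontinuous_bounded g &
    (h : X -> R) = g %[ae mu]].

Lemma equicontinuous_class (g : X -> R) : equicontinuous_bounded g ->
  exists h : L, (h : X -> R) = g %[ae mu].
Proof.
move=> gS; have mg := equicontinuous_bounded_measurable gS.
have [K _ NK] := lorentz_norm_le_interpolation p_gt1 q_ge1
  (or_introl erefl : is_lorentz_norm mu p q (lorentz_norm mu p q)).
apply: lorentz_space_class => //.
have JV0 : 0 < J * V by rewrite mulr_gt0.
apply: le_lt_trans (NK g J (J * V) mg J_gt0 JV0 gS.1 _) _; last exact: ltry.
apply: (@le_trans _ _ (\int[mu]_x (cst J%:E x))%E).
  by apply: ge0_le_integralW => x _; rewrite lee_fin//; exact: gS.1.
by rewrite integral_cst// EFinM lee_pmul2l.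
Qed.

(** An Arzela-Ascoli argument: the pointwise limit along an ultrafilter keeps the bound and the
    modulus, and closeness at finitely many points gives closeness in [N]. *)
Lemma compact_equicontinuous_classes : compact equicontinuous_classes.
Proof.
rewrite compact_ultra => F UF FK; have FF : ProperFilter F by exact:
  ultra_proper.
(* [phi h] is an equicontinuous function in the class [h], so that pointwise values are meaningful;
   other classes get 0. *)
have /choice[phi phiP] (h : L) : exists g : X -> R, equicontinuous_classes h ->
    equicontinuous_bounded g /\ (h : X -> R) = g %[ae mu].
  have [[g gS hg]|nh] := pselect (equicontinuous_classes h); first by exists g.
  by exists (cst 0).
have /choice[g0 g0P] (x : X) : exists l : R, forall e, 0 < e ->
    F [set h | `|phi h x - l| <= e].
  apply: (@ultra_bounded_cvg _ F (fun h => phi h x) J) => //.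
  by apply: filterS FK => h /phiP[[phiJ _] _]; exact: phiJ.
have g0S : equicontinuous_bounded g0.
  split=> [x|x delta delta0 y xy]; apply/ler_addgt0Pl => e e0.
    have [h [/phiP[[phiJ _] _] /= hx]] := filter_ex (filterI FK (g0P x _ e0)).
    have := ler_normB (phi h x) (phi h x - g0 x); rewrite subKr.
    by have := phiJ x; lra.
  have e20 : 0 < e / 2 by rewrite divr_gt0.
  have [h [[/phiP[[_ phi_rho] _] /= hx] hy]] :=
    filter_ex (filterI (filterI FK (g0P x _ e20)) (g0P y _ e20)).
  have -> : g0 x - g0 y =
      (phi h x - phi h y) - (phi h x - g0 x) + (phi h y - g0 y) by ring.
  apply: (le_trans (ler_normD _ _)).
  have := ler_normB (phi h x - phi h y) (phi h x - g0 x).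
  by have := phi_rho _ _ delta0 _ xy; move: hx hy => /=; lra.
have mg0 := equicontinuous_bounded_measurable g0S.
have [h0 h0g0] := equicontinuous_class g0S.
exists h0; split; first by exists g0.
move=> W /=; rewrite nbhsE => -[U [oU Uh0] UW].
have [e e0 eU] := oU _ Uh0.
have [K K0 NK] := lorentz_norm_le_interpolation p_gt1 q_ge1 N_norm.
have J2 : 0 < 2 * J by rewrite mulr_gt0.
(* Chosen so that the interpolation bound with [a = 2 * J] is exactly [e / 2]. *)
pose b := (2 * J) * (e / (2 * K * (2 * J))) `^ p.
have b0 : 0 < b by rewrite mulr_gt0// powR_gt0 ?divr_gt0 ?mulr_gt0.
have [s [delta [delta0 s_close]]] := equicontinuous_L1_close b0.
apply: filterS (filterI FK (filter_forall_seq s _ (fun x => g0P x _ delta0))).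
move=> h [/phiP[phiS hphi] hs]; apply: UW; apply: eU.
have mphi := equicontinuous_bounded_measurable phiS.
rewrite (lorentz_norm_ae_eq N_norm (_ : measurable_fun _ _)
  (_ : measurable_fun _ (fun x => phi h x - g0 x))); first last.
- by apply: filterS2 hphi h0g0 => x /= -> // ->.
- by apply: measurable_funB.
- by apply: measurable_funB; exact: lorentz_fun_measurable.
apply: le_lt_trans (NK _ (2 * J) b _ J2 b0 _ (s_close _ _ phiS g0S hs)) _.
- exact: measurable_funB.
- move=> x; apply: (le_trans (ler_normB _ _)).
  by have := phiS.1 x; have := g0S.1 x; lra.
have bE : (b / (2 * J)) `^ p^-1 = e / (2 * K * (2 * J)).
  rewrite /b mulrC mulKf ?gt_eqF// -powRrM mulfV ?gt_eqF// powRr1//.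
  by rewrite ltW// divr_gt0// !mulr_gt0.
rewrite bE lte_fin (_ : K * _ = e / 2); last by field; rewrite !gt_eqF.
by rewrite ltr_pdivrMr// ltr_pMr// ltr1n.
Qed.

End equicontinuous_compact.

(** * Separation of points and compactness on bounded spaces *)

Section averaging_bounded.
Context {R : realType} {d : measure_display} {X : metricMeasurableType R d}.
Variable mu : {measure set X -> \bar R}.
Variables (p : R) (q : \bar R) (r : R).
Hypotheses (p_gt1 : 1 < p) (q_ge1 : (1 <= q)%E) (r_gt0 : 0 < r).
Hypothesis open_measurable : forall U : set X, open U -> measurable U.
Hypothesis ball_gt0_ltoo : forall (x : X) (s : R), 0 < s ->
  (0 < mu (cball x s) < +oo)%E.
Variable N : (X -> R) -> \bar R.
Hypothesis N_norm : is_lorentz_norm mu p q N.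
Local Notation L := (lorentz_space mu p q N).

Let L1dist (f g : X -> R) : \bar R := (\int[mu]_x `|f x - g x|%:E)%E.

Let L1dist_triangle (f g h : X -> R) : measurable_fun [set: X] f ->
  measurable_fun [set: X] g -> measurable_fun [set: X] h ->
  (L1dist f h <= L1dist f g + L1dist g h)%E.
Proof.
move=> mf mg mh.
have mnorm (u v : X -> R) : measurable_fun [set: X] u ->
    measurable_fun [set: X] v ->
    measurable_fun [set: X] (fun x => `|u x - v x|%:E).
  move=> mu_ mv; apply/measurable_EFinP/measurableT_comp => //.
  exact: measurable_funB.
rewrite /L1dist -ge0_integralD//; [|exact: mnorm..].
apply: ge0_le_integralW => x _; first by rewrite lee_fin.
by rewrite -EFinD lee_fin ler_distD.
Qed.

(** The [L^1] distance is at most a constant times [N] of the difference, so [L^1]-balls are open;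
    two of them separate distinct classes. This is used to see that a compact set is closed. *)
Lemma lorentz_space_hausdorff (V : R) : 0 < V -> (mu [set: X] <= V%:E)%E ->
  hausdorff_space L.
Proof.
move=> V0 muTV; have muT : (mu [set: X] < +oo)%E.
  by apply: le_lt_trans muTV _; rewrite ltry.
have [C C0 CN] := integral_le_norm_bounded p_gt1 q_ge1 N_norm V0 muTV.
have mL (h : L) : measurable_fun [set: X] (h : X -> R).
  exact: lorentz_fun_measurable.
have fin (f g : L) : L1dist f g \is a fin_num.
  have int_ (h : L) : mu.-integrable [set: X] (EFin \o (h : X -> R)).
    exact: lorentz_space_integrable.
  apply: integrable_fin_num => //.
  by have /integrable_abse := integrableB measurableT (int_ f) (int_ g).
have sym (f g : X -> R) : L1dist f g = L1dist g f.
  by apply: eq_integral => x _; rewrite distrC.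
pose ball1 (f : L) (e : R) : set L := [set h : L | (L1dist h f < e%:E)%E].
have open_ball1 f e : open (ball1 f e).
  move=> h hf; pose a := fine (L1dist h f).
  have aE : L1dist h f = a%:E by rewrite /a fineK.
  have ae : a < e by move: hf; rewrite /ball1/= aE lte_fin.
  exists ((e - a) / (2 * C)); first by rewrite divr_gt0 ?subr_gt0// mulr_gt0.
  move=> k /ltW kh; apply: le_lt_trans (L1dist_triangle (mL k) (mL h) (mL f)) _.
  have e'0 : 0 < (e - a) / (2 * C) by rewrite divr_gt0 ?subr_gt0// mulr_gt0.
  have := CN _ _ (measurable_funB (mL k) (mL h)) e'0 kh.
  rewrite (_ : C * _ = (e - a) / 2); last by field; rewrite gt_eqF.
  rewrite -/(L1dist k h) => /leeD2r/le_lt_trans; apply.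
  by rewrite aE -EFinD lte_fin; lra.
rewrite open_hausdorff => f' g'; move: (f' : L) (g' : L) => {f' g'} f g fg.
have D0 : 0 < fine (L1dist f g).
  rewrite lt_neqAle fine_ge0 ?integral_ge0// andbT eq_sym.
  apply: contra fg => /eqP D0; apply/eqP; apply: lorentz_space_eq.
  have : (\int[mu]_x `|(f x - g x)%:E| = 0)%E.
    by rewrite -[LHS](fineK (fin f g)) -[X in X = _]/((fine (L1dist f g))%:E)
      D0.
  move=> /(ae_eq_integral_abs mu measurableT) H.
  have /H : measurable_fun [set: X] (EFin \o (fun x => f x - g x)).
    by apply/measurable_EFinP; exact: measurable_funB.
  apply: filterS => x /= H0 xT; have [] := H0 xT.
  by move=> /eqP; rewrite subr_eq0 => /eqP.
pose e := fine (L1dist f g) / 2; have e0 : 0 < e by rewrite divr_gt0.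
have center h : ball1 h e h.
  rewrite /ball1/= /L1dist; under eq_integral do rewrite subrr normr0.
  by rewrite integral0 lte_fin.
exists (ball1 f e, ball1 g e) => /=; first by rewrite !inE.
split; [exact: open_ball1|exact: open_ball1|].
apply/eqP; rewrite -subset0 => h [hf hg].
have := L1dist_triangle (mL f) (mL h) (mL g); apply/negP; rewrite -ltNge.
rewrite sym; apply: (lt_le_trans (lteD hf hg)).
by rewrite -EFinD -[leRHS]fineK// lee_fin /e; lra.
Qed.

Hypothesis mu_doubling : forall s : R, r <= s -> doubling mu s.
Hypothesis mu_vitali : vitali_covering_property mu.
Hypothesis ball_continuity : forall x : X,
  mu (cball x r `+` cball y r) @[y --> x] --> 0%E.

Lemma bounded_average_compact : bounded_space X ->
  averaging_operator_compact mu p q N r.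
Proof.
move=> /(bounded_space_measure r_gt0 ball_gt0_ltoo mu_doubling)
  [V [c [V0 c0 muTV ball_ge]]].
(* [P] is [lorentz_norm] when [T] is built, since that norm is finite on the whole space, and [N]
   when a bounded set is treated. *)
have equi M (P : (X -> R) -> \bar R) : is_lorentz_norm mu p q P -> 0 < M ->
    exists (J : R) (rho : X -> R -> R), [/\ 0 < J,
      forall x delta, 0 < delta -> 0 < rho x delta &
      forall f : L, (P f <= M%:E)%E ->
        equicontinuous_bounded J rho (average mu r f)].
  move=> P_norm M0.
  have [J J0 JP] := average_bounded p_gt1 q_ge1 r_gt0 open_measurable
    ball_gt0_ltoo P_norm V0 c0 muTV ball_ge M0.
  have /choice[rho rhoP] (xd : X * R) : exists rho : R, 0 < xd.2 -> 0 < rho /\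
      forall (f : X -> R) (y : X), measurable_fun [set: X] f ->
        (P f <= M%:E)%E -> mdist xd.1 y <= rho ->
        `|average mu r f xd.1 - average mu r f y| <= xd.2.
    have [d0|] := ltP 0 xd.2; last by exists 0.
    have [rho rho0 rhoP] := average_equicontinuous p_gt1 q_ge1 r_gt0
      open_measurable ball_gt0_ltoo ball_continuity P_norm V0 c0 muTV ball_ge
      xd.1 M0 d0.
    by exists rho.
  exists (J / c), (fun x delta => rho (x, delta)); split.
  - by rewrite divr_gt0.
  - by move=> x delta delta0; have [] := rhoP (x, delta) delta0.
  - move=> f PfM; have mf := lorentz_fun_measurable f.
    split=> [x|x delta delta0 y]; first by have [] := JP f x mf PfM.
    by have [_] := rhoP (x, delta) delta0; exact.
have /choice[T TP] (f : L) : exists g : L,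
    {ae mu, forall x, g x = average mu r f x}.
  pose M := fine (lorentz_norm mu p q f) + 1.
  have Nf0 := lorentz_norm_ge0 mu p q f.
  have Nfoo : (lorentz_norm mu p q f < +oo)%E := svalP f.
  have M0 : 0 < M by rewrite ltr_wpDl// fine_ge0.
  have NM : (lorentz_norm mu p q f <= M%:E)%E.
    rewrite /M EFinD fineK ?leeDl ?lee_fin//.
    by rewrite fin_numElt Nfoo (lt_le_trans _ Nf0).
  have [J [rho [J0 rho0 fP]]] := equi M _ (or_introl erefl) M0.
  have [g gP] := equicontinuous_class p_gt1 q_ge1 open_measurable V0 J0 muTV
    rho0 N (fP f NM).
  by exists g; apply: filterS gP => x /(_ Logic.I).
exists T => // E [M EM].
have M0 : 0 < Num.max M 1 by rewrite lt_max ltr01 orbT.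
have [J [rho [J0 rho0 fP]]] := equi _ _ N_norm M0.
have cK := compact_equicontinuous_classes p_gt1 q_ge1 open_measurable mu_vitali
  V0 J0 muTV rho0 N_norm.
(* The image lies in a compact, hence closed, set, which therefore contains its closure. *)
have TK : T @` E `<=` (equicontinuous_classes J rho (N := N) : set L).
  move=> _ [f Ef <-]; exists (average mu r f).
    by apply: fP; apply: (le_trans (EM _ Ef)); rewrite lee_fin le_max lexx.
  by apply: filterS (TP f) => x ->.
apply: (subclosed_compact _ cK); first exact: closed_closure.
have /closure_id -> : closed (equicontinuous_classes J rho (N := N) : set L).
  by apply: (compact_closed _ cK); exact: (lorentz_space_hausdorff V0 muTV).
exact: closure_subset.
Qed.

End averaging_bounded.

Theorem corollary1p3 (R : realType) (d : measure_display)
    (X : metricMeasurableType R d) (mu : {measure set X -> \bar R})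
    (r : R) (p : R) (q : \bar R)
    (open_measurable : forall U : set X, open U -> measurable U)
    (ball_gt0_ltoo : forall (x : X) (s : R), 0 < s ->
      (0 < mu (cball x s) < +oo)%E)
    (r_gt0 : 0 < r)
    (mu_doubling : forall s : R, r <= s -> doubling mu s)
    (mu_vitali : vitali_covering_property mu)
    (ball_continuity : forall x : X,
      mu (cball x r `+` cball y r) @[y --> x] --> 0%E)
    (p_gt1 : 1 < p) (q_ge1 : (1 <= q)%E) :
  (averaging_operator_compact mu p q (lorentz_norm mu p q) r
     <-> bounded_space X) /\
  (averaging_operator_compact mu p q (lorentz_maximal_norm mu p q) r
     <-> bounded_space X).
Proof.
have iff_N N : is_lorentz_norm mu p q N ->
    averaging_operator_compact mu p q N r <-> bounded_space X.
  move=> N_norm; split.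
  - exact: (average_compact_bounded p_gt1 q_ge1 r_gt0 open_measurable
      ball_gt0_ltoo N_norm (mu_doubling r (lexx r))).
  - exact: (bounded_average_compact p_gt1 q_ge1 r_gt0 open_measurable
      ball_gt0_ltoo N_norm mu_doubling mu_vitali ball_continuity).
by split; apply: iff_N; [left|right].
Qed.
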